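(* Let $d\ge1$ and $\Lambda=(0,\infty)^d$. (1) Let $a,\lambda\in\Lambda$. If $F:\mathbb{R}^d\to\mathbb{R}$ is an integrable function that satisfies (i) $F(x)\le G_\lambda(x)$ for each $x\in\mathbb{R}^d$, and (ii) $\hat F(\xi)=0$ for each $\xi\notin Q(a)$, then $$\int_{\mathbb{R}^d}F(x)\,dx\ \le\ \prod_{j=1}^d\lambda_j^{-1/2}\,\Theta(\tfrac12;ia_j^2/\lambda_j).$$ (2) Furthermore, there exists a positive constant $\gamma_0=\gamma_0(d)$, depending only on $d$, such that for all $a,\lambda\in\Lambda$, if $\gamma:=\min\{a_j^2/\lambda_j:1\le j\le d\}\ge\gamma_0$, then $$\prod_{j=1}^d\lambda_j^{-1/2}\,\Theta(\tfrac12;ia_j^2/\lambda_j)\ \le\ (1+5d\,e^{-\pi\gamma})\int_{\mathbb{R}^d}L_{\lambda,a}(x)\,dx .$$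
   Context: Notation: for $\lambda\in\Lambda$, $G_\lambda(x)=\prod_{j=1}^d e^{-\lambda_j\pi x_j^2}$ for $x\in\mathbb{R}^d$. For $a\in\Lambda$, $Q(a)=\prod_{j=1}^d[-a_j,a_j]$. The Fourier transform is $\hat F(\xi)=\int_{\mathbb{R}^d}e^{-2\pi i x\cdot\xi}F(x)\,dx$. Jacobi's theta function is $\Theta(v;\tau)=\sum_{n\in\mathbb{Z}}e^{2\pi i nv}e^{\pi i\tau n^2}$ for $\operatorname{Im}\tau>0$. For $\delta>0$ let $g_\delta(t)=e^{-\delta\pi t^2}$ and let $l_\delta,m_\delta$ be the entire functions $$l_\delta(z)=\Big(\frac{\cos\pi z}{\pi}\Big)^2\Big\{\sum_{k\in\mathbb{Z}}\frac{g_\delta(k+\frac12)}{(z-k-\frac12)^2}+\sum_{k\in\mathbb{Z}}\frac{g_\delta'(k+\frac12)}{z-k-\frac12}\Big\},$$ $$m_\delta(z)=\Big(\frac{\sin\pi z}{\pi}\Big)^2\Big\{\sum_{k\in\mathbb{Z}}\frac{g_\delta(k)}{(z-k)^2}+\sum_{k\in\mathbb{Z}}\frac{g_\delta'(k)}{z-k}\Big\}$$ (removable singularities filled in). For $\lambda\in\Lambda$ put $$L_\lambda(z)=-(d-1)\prod_{j=1}^d m_{\lambda_j}(z_j)+\sum_{k=1}^d l_{\lambda_k}(z_k)\prod_{\substack{1\le j\le d\\ j\ne k}}m_{\lambda_j}(z_j),$$ and for $a,\lambda\in\Lambda$ put $L_{\lambda,a}(z)=L_{\lambda/a^2}(az)$,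 where operations on vectors are coordinatewise: $\lambda/a^2=(\lambda_1/a_1^2,\dots,\lambda_d/a_d^2)$, $az=(a_1z_1,\dots,a_dz_d)$. *)

(* Defs.v *)
From HB Require Import structures.
From mathcomp Require Import all_boot all_order all_algebra.
From mathcomp Require Import all_classical all_reals all_analysis.
From mathcomp Require Import complex.
Set Implicit Arguments.
Unset Strict Implicit.
Unset Printing Implicit Defensive.
Import Order.TTheory GRing.Theory Num.Theory.
Import numFieldNormedType.Exports.
Local Open Scope classical_set_scope.
Local Open Scope ring_scope.

Section LebesgueMeasureRn.
Variable R : realType.

(* R^n carrying the product (= Borel) sigma-algebra *)
Definition borelRn (n : nat) := n.-tuple (measurableTypeR R).

HB.instance Definition _ n := Measurable.on (borelRn n).

Definition consRn n (p : measurableTypeR R * borelRn n) : borelRn n.+1 :=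
  [tuple of p.1 :: p.2].

Lemma measurable_consRn n : measurable_fun [set: _] (@consRn n).
Proof. exact: measurable_cons. Qed.

HB.instance Definition _ n :=
  isMeasurableFun.Build _ _ _ _ (@consRn n) (@measurable_consRn n).

Section step.
Variables (n : nat) (mu : {sigma_finite_measure set (borelRn n) -> \bar R}).

Definition stepRn : set (borelRn n.+1) -> \bar R :=
  pushforward (@lebesgue_measure R \x mu)%E (@consRn n).

Let step0 : stepRn set0 = 0%E.
Proof. by rewrite /stepRn /pushforward preimage_set0 measure0. Qed.

Let step_ge0 A : (0 <= stepRn A)%E.
Proof. exact: measure_ge0. Qed.

Let step_sigma_additive : semi_sigma_additive stepRn.
Proof.
exact: (@measure_semi_sigma_additive _ _ _
  (pushforward (@lebesgue_measure R \x mu)%E (@consRn n))).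
Qed.

HB.instance Definition _ :=
  isMeasure.Build _ _ _ stepRn step0 step_ge0 step_sigma_additive.

Let step_sigma_finite : sigma_finite [set: _] stepRn.
Proof.
have /sigma_finiteP[F [TF ndF Foo]] := sigma_finiteT (@lebesgue_measure R).
have /sigma_finiteP[G [TG ndG Goo]] := sigma_finiteT mu.
pose u := fun x : borelRn n.+1 =>
  (thead x : measurableTypeR R, [tuple of behead x] : borelRn n).
have mu_ : measurable_fun [set: _] u.
  apply/measurable_fun_pairP; split => /=.
    exact: measurable_tnth.
  exact: measurable_behead.
have consK p : u (consRn p) = p.
  by case: p => a b; rewrite /u theadE; congr pair; apply/val_inj.
have uK k : @consRn n @^-1` (u @^-1` (F k `*` G k)) = F k `*` G k.
  apply/funext => p; rewrite -[in RHS](consK p); exact: erefl.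
exists (fun k => u @^-1` (F k `*` G k)).
  rewrite -preimage_bigcup (_ : \bigcup_i _ = setT) ?preimage_setT//.
  rewrite -setXTT TF TG predeqE => -[x y]; split.
    by move=> [n0 _ []/= ? ?]; split; exists n0.
  move=> [/= [n0 _ Fnx] [k _ Gky]]; exists (maxn n0 k) => //; split.
  - by move: x Fnx; exact/subsetPset/ndF/leq_maxl.
  - by move: y Gky; exact/subsetPset/ndG/leq_maxr.
move=> k; have [? ?] := Foo k; have [? ?] := Goo k; split.
  by rewrite -[X in measurable X]setTI; apply: mu_ => //; exact: measurableX.
rewrite /stepRn /pushforward uK product_measure1E//.
by rewrite lte_mul_pinfty// ge0_fin_numE.
Qed.

HB.instance Definition _ :=
  Measure_isSigmaFinite.Build _ _ _ stepRn step_sigma_finite.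

End step.

Fixpoint borel_lebesgueRn (n : nat) :
    {sigma_finite_measure set (borelRn n) -> \bar R} :=
  match n with
  | 0 => dirac ([tuple] : borelRn 0)
  | n'.+1 => stepRn (borel_lebesgueRn n')
  end.

(* R^n carrying the Lebesgue sigma-algebra: a function on Rn is measurable
   when it is Lebesgue measurable, not merely Borel measurable *)
Definition Rn (n : nat) := caratheodory_type (borel_lebesgueRn n)^*%mu.

HB.instance Definition _ n := Measurable.on (Rn n).

Definition lebesgueRn (n : nat) : set (Rn n) -> \bar R :=
  @completed_measure_extension _ _ _ (borel_lebesgueRn n).

HB.instance Definition _ n := Measure.on (@lebesgueRn n).

End LebesgueMeasureRn.

Section Functions.
Variable R : realType.

Definition coordRn d (x : Rn R d) (j : 'I_d) : R := tnth x j.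

Definition dotRn d (x y : Rn R d) : R := \sum_(j < d) coordRn x j * coordRn y j.

Definition Lambda d : set (Rn R d) := [set l | forall j, 0 < coordRn l j].

Definition boxQ d (a : Rn R d) : set (Rn R d) :=
  [set x | forall j, - coordRn a j <= coordRn x j <= coordRn a j].

Definition integralRn d (f : Rn R d -> R) : R :=
  Rintegral (@lebesgueRn R d) [set: Rn R d] f.

Definition integrableRn d (f : Rn R d -> R) : Prop :=
  (@lebesgueRn R d).-integrable [set: Rn R d] (EFin \o f).

Definition cintegralRn d (f : Rn R d -> R[i]) : R[i] :=
  Complex (integralRn (fun x => complex.Re (f x)))
          (integralRn (fun x => complex.Im (f x))).

(* Sum over the integers, as the sum of the series over k >= 0 and over k < 0
   (Negz n is - n.+1); all the sums taken below converge absolutely. *)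
Definition sumZ (u : int -> R) : R :=
  limn [series u (Posz n)]_n + limn [series u (Negz n)]_n.

Definition csumZ (u : int -> R[i]) : R[i] :=
  Complex (sumZ (fun k => complex.Re (u k))) (sumZ (fun k => complex.Im (u k))).

Definition cexp (z : R[i]) : R[i] :=
  Complex (expR (complex.Re z) * cos (complex.Im z))
          (expR (complex.Re z) * sin (complex.Im z)).

Definition ci : R[i] := Complex 0 1.

Definition fourier d (F : Rn R d -> R) (xi : Rn R d) : R[i] :=
  cintegralRn (fun x =>
    cexp (- 2 * pi%:C%C * ci * (dotRn x xi)%:C%C) * (F x)%:C%C).

Definition Theta (v tau : R[i]) : R[i] :=
  csumZ (fun n => cexp (2 * pi%:C%C * ci * n%:~R * v) *
                  cexp (pi%:C%C * ci * tau * n%:~R ^+ 2)).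

Definition gauss (delta t : R) : R := expR (- delta * pi * t ^+ 2).

Definition Gauss d (l x : Rn R d) : R :=
  \prod_(j < d) gauss (coordRn l j) (coordRn x j).

(* Only the values on the real axis of the entire functions l_delta, m_delta
   are defined; at a point of the lattice of nodes the value is the limit of
   the formula, which fills in the removable singularity. *)
Definition l_formula (delta z : R) : R :=
  (cos (pi * z) / pi) ^+ 2 *
  (sumZ (fun k => gauss delta (k%:~R + 2^-1) / (z - k%:~R - 2^-1) ^+ 2) +
   sumZ (fun k => derive1 (gauss delta) (k%:~R + 2^-1) / (z - k%:~R - 2^-1))).

Definition l_ (delta z : R) : R :=
  if z - 2^-1 \is a Num.int then lim (l_formula delta y @[y --> z^'])
  else l_formula delta z.

Definition m_formula (delta z : R) : R :=
  (sin (pi * z) / pi) ^+ 2 *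
  (sumZ (fun k => gauss delta k%:~R / (z - k%:~R) ^+ 2) +
   sumZ (fun k => derive1 (gauss delta) k%:~R / (z - k%:~R))).

Definition m_ (delta z : R) : R :=
  if z \is a Num.int then lim (m_formula delta y @[y --> z^'])
  else m_formula delta z.

Definition L_ d (l z : Rn R d) : R :=
  - (d%:R - 1) * (\prod_(j < d) m_ (coordRn l j) (coordRn z j)) +
  \sum_(k < d) l_ (coordRn l k) (coordRn z k) *
    \prod_(j < d | j != k) m_ (coordRn l j) (coordRn z j).

Definition L_scaled d (l a z : Rn R d) : R :=
  L_ ([tuple coordRn l j / coordRn a j ^+ 2 | j < d] : Rn R d)
     ([tuple coordRn a j * coordRn z j | j < d] : Rn R d).

(* minimum of a nonempty finite family (junk when d = 0) *)
Definition min_ord d (f : 'I_d -> R) : R :=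
  \big[Num.min/head 0 (codom f)]_(j < d) f j.

End Functions.

(* Main.v *)
(* Upper bound.  The d-fold product K_N of Fejér kernels, with variables
   b_j x_j - 1/2 for some b_j > a_j, is a nonnegative trigonometric polynomial
   all of whose nonzero frequencies lie outside Q(a), and its constant term is
   1, so the integral of F is that of F * K_N, which is at most that of
   G_lambda * K_N.  The latter is a product of Cesàro means of the theta
   series; let b tend to a, then N to infinity.

   Lower bound.  The integrals of m_delta and l_delta are the sums of g_delta
   over Z and over Z + 1/2: the squared sinc terms have integral 1, and the
   1/(z - k) terms cancel in pairs of opposite nodes.  Poisson summation turns
   these sums into theta values, and with r_j = Theta(1/2) / Theta(0) at
   i a_j^2 / lambda_j the claim becomes
     prod r_j <= (1 + 5 d q) (1 - sum (1 - r_j)),  q = exp(- pi gamma),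
   which holds because r_j <= 1 and 1 - r_j <= (9/2) q. *)
Require Import Defs.
From HB Require Import structures.
From mathcomp Require Import all_boot all_order all_algebra.
From mathcomp Require Import all_classical all_reals all_analysis.
From mathcomp Require Import measurable_realfun complex ring lra.
Set Implicit Arguments.
Unset Strict Implicit.
Unset Printing Implicit Defensive.
Import Order.TTheory GRing.Theory Num.Theory.
Import numFieldNormedType.Exports.
Local Open Scope classical_set_scope.
Local Open Scope ring_scope.

(** * Integrals as a predicate *)

(** For each N and b the upper bound evaluates the transform of F at finitely many frequencies, so
    nothing beyond integrability of F enters. The inequality b_j > a_j is strict because Q(a) is
    closed and contains the frequencies with coordinates a_j. The shift by 1/2 produces the
    alternating signs of Theta(1/2).

    The same kernel serves twice more: stretched over one period it tends to sinc², which yields the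
    integral of sinc², and as an approximate identity on unit intervals it proves Poisson summation
    for Gaussians.

    The obstacle in the lower bound is that sin²(pi u) / u is not absolutely integrable, so the
    terms in 1 / (z - k) cannot be integrated one at a time. A difference of two of them decays like
    1 / z², and after damping its integral vanishes by translation invariance.

    A parameter e, equal to 0 or 1, treats m (nodes Z) and l (nodes Z + 1/2) together. *)

Section has_integral.
Context d (T : measurableType d) (R : realType).
Variable mu : {measure set T -> \bar R}.
Implicit Types (f g : T -> R) (v w : R).

Definition has_integral f v :=
  mu.-integrable [set: T] (EFin \o f) /\ Rintegral mu [set: T] f = v.

Lemma has_integral_measurable f v : has_integral f v -> measurable_fun [set: T] f.
Proof. by move=> [/integrableP[/measurable_EFinP]]. Qed.

Lemma integrable_has_integral f :
  mu.-integrable [set: T] (EFin \o f) -> has_integral f (Rintegral mu [set: T] f).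
Proof. by []. Qed.

Lemma has_integral_eq f g v w : f =1 g -> v = w ->
  has_integral f v -> has_integral g w.
Proof. by move=> /funext -> ->. Qed.

Lemma has_integral_uniq f v w : has_integral f v -> has_integral f w -> v = w.
Proof. by move=> [_ <-] [_ <-]. Qed.

Lemma has_integralZ r f v : has_integral f v ->
  has_integral (fun x => r * f x) (r * v).
Proof.
by move=> [If <-]; split; [exact: (integrableZl _ r If)|exact: RintegralZl].
Qed.

Lemma has_integralD f g v w : has_integral f v -> has_integral g w ->
  has_integral (fun x => f x + g x) (v + w).
Proof.
by move=> [If <-] [Ig <-]; split; [exact: (integrableD _ If Ig)|exact: RintegralD].
Qed.

Lemma has_integralB f g v w : has_integral f v -> has_integral g w ->
  has_integral (fun x => f x - g x) (v - w).
Proof.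
by move=> [If <-] [Ig <-]; split; [exact: (integrableB _ If Ig)|exact: RintegralB].
Qed.

Lemma has_integral0 : has_integral (fun=> 0) 0.
Proof.
split; first exact: integrable0.
by rewrite /Rintegral integral0_eq.
Qed.

Lemma has_integral_sum I (r : seq I) (f : I -> T -> R) (v : I -> R) :
  (forall i, has_integral (f i) (v i)) ->
  has_integral (fun x => \sum_(i <- r) f i x) (\sum_(i <- r) v i).
Proof.
move=> fv; elim: r => [|i r IH].
  rewrite big_nil; apply: has_integral_eq has_integral0 => // x.
  by rewrite big_nil.
rewrite big_cons.
apply: has_integral_eq (has_integralD (fv i) IH) => // x.
by rewrite big_cons.
Qed.

Lemma has_integral_le f g v w : (forall x, f x <= g x) ->
  has_integral f v -> has_integral g w -> v <= w.
Proof. by move=> fg [If <-] [Ig <-]; apply: le_Rintegral. Qed.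

Lemma has_integral_norm_le f g v w : (forall x, `|f x| <= g x) ->
  has_integral f v -> has_integral g w -> `|v| <= w.
Proof.
move=> fg If Ig; have Nf : forall x, - g x <= f x <= g x.
  by move=> x; rewrite -ler_norml.
rewrite ler_norml; apply/andP; split.
- have := has_integralZ (-1) Ig; rewrite mulN1r => IgN.
  by apply: has_integral_le IgN If => x; rewrite mulN1r; case/andP: (Nf x).
- by apply: has_integral_le If Ig => x; case/andP: (Nf x).
Qed.

Lemma integrable_dominated f g : measurable_fun [set: T] f ->
  (forall x, `|f x| <= g x) -> mu.-integrable [set: T] (EFin \o g) ->
  mu.-integrable [set: T] (EFin \o f).
Proof.
move=> mf fg; apply: le_integrable => //; first exact/measurable_EFinP.
by move=> x _ /=; rewrite lee_fin (le_trans (fg x))// ler_norm.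
Qed.

(** The exceptional null set [N] is an explicit argument: it will be {0} for sinc² and the set of
    nodes for the interpolants. *)
Lemma has_integral_dct (N : set T) (f_ : nat -> T -> R) (v : nat -> R) f g :
  measurable N -> mu N = 0%E ->
  (forall n, has_integral (f_ n) (v n)) ->
  measurable_fun [set: T] f ->
  (forall x, ~ N x -> f_ n x @[n --> \oo] --> f x) ->
  (forall n x, ~ N x -> `|f_ n x| <= g x) ->
  mu.-integrable [set: T] (EFin \o g) ->
  has_integral f (Rintegral mu [set: T] f) /\
  v n @[n --> \oo] --> Rintegral mu [set: T] f.
Proof.
move=> mN N0 fv mf ff fg Ig.
have [] := @dominated_convergence _ T R mu setT measurableT
  (fun n => EFin \o f_ n) (EFin \o f) (EFin \o g).
- by move=> n; have [/integrableP[]] := fv n.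
- exact/measurable_EFinP.
- exists N; split => // x /= /not_implyP[_ nf]; apply: contrapT => Nx.
  by apply: nf; apply: cvg_EFin; [exact: nearW|exact: ff].
- exact: Ig.
- exists N; split => // x /= /existsNP[n /not_implyP[_ nf]].
  by apply: contrapT => Nx; apply: nf; rewrite /= lee_fin; exact: fg.
move=> If _ cv; split; first exact: integrable_has_integral.
have -> : v = fine \o (fun n => (\int[mu]_x (f_ n x)%:E)%E).
  by apply/funext => n /=; have [_ <-] := fv n.
apply: fine_cvg; rewrite fineK//.
exact: integrable_fin_num.
Qed.

End has_integral.

(** * Change of variables *)

Section transport.
Context d1 d2 (X : measurableType d1) (Y : measurableType d2) (R : realType).
Variables (phi : X -> Y) (m1 : {measure set X -> \bar R}) (m2 : {measure set Y -> \bar R}).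
Variable k : R.
Hypothesis k_gt0 : 0 < k.
Hypothesis mphi : measurable_fun [set: X] phi.
Hypothesis m12 : forall A, measurable A -> m2 A = (k%:E * m1 (phi @^-1` A))%E.

Local Open Scope ereal_scope.

Lemma ge0_integral_transport (f : Y -> \bar R) : measurable_fun [set: Y] f ->
  (forall y, 0 <= f y) -> \int[m2]_y f y = k%:E * \int[m1]_x f (phi x).
Proof.
move=> mf f0.
pose k' := NngNum (ltW k_gt0).
rewrite -[X in _ = _ * X](@ge0_integral_pushforward _ _ X Y R phi mphi m1 setT)//.
rewrite -(@ge0_integral_mscale _ _ R (pushforward m1 phi) setT measurableT k')//.
by apply: eq_measure_integral => A mA _; rewrite m12.
Qed.

(** [k] is the Jacobian. The maps in use are the affine maps of the line, the splitting of a tuple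
    into head and tail, and the identity from the Lebesgue to the Borel sigma-algebra of R^n, the
    last two with [k = 1]. *)
Lemma has_integral_transport (f : Y -> R) v : has_integral m2 f v ->
  has_integral m1 (f \o phi) (v / k).
Proof.
move=> fv; have mf := has_integral_measurable fv; case: fv => If <-.
have mfE : measurable_fun setT (EFin \o f) by exact/measurable_EFinP.
have I1 : m1.-integrable setT (EFin \o (f \o phi)).
  apply/integrableP; split; first exact/measurable_EFinP/measurableT_comp.
  have /integrableP[_] := If.
  rewrite ge0_integral_transport//; last exact: measurableT_comp.
  have [->|] := eqVneq (\int[m1]_x `|(EFin \o (f \o phi)) x|) +oo.
    by rewrite gt0_muley ?lte_fin.
  by rewrite -ltey.
split => //; rewrite /Rintegral.
suff -> : \int[m2]_x (f x)%:E = k%:E * \int[m1]_x (f (phi x))%:E.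
  rewrite fineM//; last exact: integrable_fin_num.
  by rewrite mulrAC divff ?mul1r// gt_eqF.
rewrite integralE [in RHS]integralE.
rewrite !ge0_integral_transport//; last 2 first.
- exact: measurable_funeneg.
- exact: measurable_funepos.
rewrite [RHS]muleBr//; last exact: (integrable_add_def measurableT I1).
have e1 x : (fun x0 : X => (f (phi x0))%:E)^\+ x = (fun x0 : Y => (f x0)%:E)^\+ (phi x).
  exact: (congr1 (@^~ x) (funepos_comp (EFin \o f) phi)).
have e2 x : (fun x0 : X => (f (phi x0))%:E)^\- x = (fun x0 : Y => (f x0)%:E)^\- (phi x).
  exact: (congr1 (@^~ x) (funeneg_comp (EFin \o f) phi)).
by under [in RHS]eq_integral do rewrite e1; under [X in _ = _ - _ * X]eq_integral do rewrite e2.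
Qed.

End transport.

Section lebesgue_affine.
Variable R : realType.
Notation mu := (@lebesgue_measure R).

Lemma lebesgue_measure_affine (a c : R) (A : set (measurableTypeR R)) : 0 < a -> measurable A ->
  mu A = (a%:E * mu ((fun x => (a * x + c)%R) @^-1` A))%E.
Proof.
move=> a0 mA; pose phi := fun x : measurableTypeR R => (a * x + c : measurableTypeR R).
have mphi : measurable_fun [set: measurableTypeR R] phi.
  by apply: measurable_funD => //; exact: measurable_funM.
rewrite (@lebesgue_measure_unique R (mscale (NngNum (ltW a0)) (pushforward mu phi)))//.
move=> X -[[x y] _ <-].
have E : phi @^-1` `]x, y] = `]((x - c) / a), ((y - c) / a)]%classic.
  apply/seteqP; split => z /=; rewrite !in_itv/= ltr_pdivrMr// ler_pdivlMr//;
   by rewrite ltrBlDr lerBrDr mulrC.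
rewrite -[RHS]/(a%:E * mu (phi @^-1` `]x, y]))%E E.
rewrite !lebesgue_measure_itv/= !lte_fin ltr_pM2r ?invr_gt0// ltrD2r.
case: ifPn => xy; last by rewrite mule0.
rewrite -!EFinD -EFinM; congr EFin; field.
by rewrite gt_eqF.
Qed.

Lemma has_integral_affine (f : R -> R) v (a c : R) : 0 < a ->
  has_integral mu f v -> has_integral mu (fun x => f (a * x + c)) (v / a).
Proof.
move=> a0 fv.
apply: (@has_integral_transport _ _ _ _ R
  (fun x : measurableTypeR R => (a * x + c : measurableTypeR R)) mu mu a a0 _ _ f v fv).
  by apply: measurable_funD => //; exact: measurable_funM.
by move=> A mA; exact: lebesgue_measure_affine.
Qed.

Lemma has_integral_shift (f : R -> R) v c :
  has_integral mu f v -> has_integral mu (fun x => f (x + c)) v.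
Proof.
move=> /(has_integral_affine c (ltr01)); apply: has_integral_eq => [x|].
  by rewrite mul1r.
by rewrite divr1.
Qed.

End lebesgue_affine.

(** * The Fourier transform of the Gaussian *)

Section real_line.
Variable R : realType.
Notation mu := (@lebesgue_measure R).
Implicit Types (f g F : R -> R).

Lemma measurable_continuous f : continuous f ->
  measurable_fun [set: measurableTypeR R] (f : measurableTypeR R -> R).
Proof. exact: continuous_measurable_fun. Qed.

Lemma continuous_fM f g : continuous f -> continuous g ->
  continuous (fun x => f x * g x).
Proof. by move=> cf cg x; exact: (cvgM (cf x) (cg x)). Qed.

Lemma continuous_fD f g : continuous f -> continuous g ->
  continuous (fun x => f x + g x).
Proof. by move=> cf cg x; exact: (cvgD (cf x) (cg x)). Qed.

Lemma continuous_fB f g : continuous f -> continuous g ->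
  continuous (fun x => f x - g x).
Proof. by move=> cf cg x; exact: (cvgB (cf x) (cg x)). Qed.

Lemma continuous_fC (c : R) : continuous (fun _ : R => c).
Proof. by move=> x; exact: cvg_cst. Qed.

Lemma continuous_fid : continuous (fun x : R => x).
Proof. by move=> x; exact: cvg_id. Qed.

Lemma integrable_oneDsqrV : mu.-integrable [set: R] (EFin \o (fun x : R => (1 + x ^+ 2)^-1)).
Proof.
have cV : continuous (fun x : R => (1 + x ^+ 2)^-1) by exact: continuous_oneDsqrV.
have V0 (x : R) : 0 <= (1 + x ^+ 2)^-1 by rewrite invr_ge0 addr_ge0 ?sqr_ge0.
apply/integrableP; split; first by apply/measurable_EFinP; exact: measurable_continuous.
under eq_integral do rewrite gee0_abs ?lee_fin//.
rewrite ge0_symfun_integralT//; last by move=> x; rewrite /= sqrrN.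
rewrite (_ : [set x | _] = `[0, +oo[%classic); last first.
  by apply/seteqP; split => x/=; rewrite in_itv/= andbT.
by rewrite (@integral0y_oneDsqr R) -EFinM ltry.
Qed.

Lemma is_derive_continuous f (df : R -> R) :
  (forall x : R, is_derive x 1 f (df x)) -> continuous f.
Proof.
move=> H x; apply: differentiable_continuous; apply/derivable1_diffP.
by apply: ex_derive.
Qed.

Lemma has_integral_itv f F (a b : R) : a < b -> continuous f ->
  (forall x : R, is_derive x 1 F (f x)) ->
  has_integral mu (fun x => f x * \1_(`[a, b[%classic) x) (F b - F a).
Proof.
move=> ab cf dF; have cF := is_derive_continuous dF.
have H : (\int[mu]_(x in `[a, b]) (f x)%:E = (F b)%:E - (F a)%:E)%E.
  apply: continuous_FTC2 => //.
  - exact: continuous_subspaceT.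
  - split.
    + by move=> x _; exact: ex_derive.
    + by apply: cvg_at_right_filter; exact: cF.
    + by apply: cvg_at_left_filter; exact: cF.
  - by move=> x _; rewrite derive1E derive_val.
have E : (fun x => f x * \1_(`[a, b[%classic) x) = f \_ `[a, b[.
  by apply/funext => x; rewrite patchE indicE; case: (x \in _); rewrite ?mulr1 ?mulr0.
have I : mu.-integrable `[a, b[ (EFin \o f).
  apply: (@integrableS _ _ _ mu `[a, b]) => //.
    by apply: subset_itv; rewrite ?bnd_simp.
  apply: continuous_compact_integrable; first exact: segment_compact.
  exact: continuous_subspaceT.
rewrite E; split; last first.
  by rewrite -Rintegral_mkcond Rintegral_itv_bndo_bndc// /Rintegral H.
rewrite -restrict_EFin; apply/integrable_restrict => //.
by rewrite setTI.
Qed.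

(** The integrals over growing intervals converge by domination by |f|, and the increments of [F]
    identify the limit. The endpoints [n.+1] keep every interval nondegenerate. *)
Lemma has_integral_FTC f F v : continuous f ->
  (forall x : R, is_derive x 1 F (f x)) ->
  mu.-integrable [set: R] (EFin \o f) ->
  F n.+1%:R - F (- n.+1%:R) @[n --> \oo] --> v -> has_integral mu f v.
Proof.
move=> cf dF If Fv.
have := @has_integral_dct _ _ _ mu set0
  (fun n x => f x * \1_(`[(- n.+1%:R), n.+1%:R[%classic) x)
  (fun n => F n.+1%:R - F (- n.+1%:R)) f (fun x => `|f x|).
case=> //.
- move=> n; apply: has_integral_itv => //.
  by rewrite (@lt_trans _ _ 0)// ?oppr_lt0 ltr0n.
- exact: measurable_continuous.
- move=> x _; apply: cvg_near_cst; near=> n.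
  rewrite indicE mem_set ?mulr1//= in_itv/=.
  have : `|x| < n.+1%:R.
    apply: (@le_lt_trans _ _ n%:R); last by rewrite ltr_nat.
    by near: n; exact: nbhs_infty_ger.
  by rewrite ltr_norml => /andP[/ltW -> ->].
- move=> n x _; rewrite normrM ler_piMr// indicE ger0_norm//.
  by case: (x \in _); rewrite ?ler01 ?lexx.
- exact: integrable_norm.
move=> Hf lf; split => //; apply: cvg_unique lf Fv.
exact: Rhausdorff.
Unshelve. all: by end_near. Qed.

End real_line.

Section gaussian.
Variable R : realType.
Notation mu := (@lebesgue_measure R).

Let ga (t : R) := expR (- t ^+ 2).

Lemma has_integral_gauss_fun : has_integral mu ga (Num.sqrt pi).
Proof.
split; first exact: integrableT_gauss.
by rewrite /Rintegral; have -> := @integralT_gauss R.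
Qed.

Lemma cvg_gauss_nat : expR (- n.+1%:R ^+ 2) @[n --> \oo] --> (0 : R).
Proof.
have H : n.+1%:R @[n --> \oo] --> (+oo : set_system R).
  apply/cvgryPge => A; near=> n.
  apply: (@le_trans _ _ n%:R); last by rewrite ler_nat.
  by near: n; exact: nbhs_infty_ger.
exact: (cvg_comp _ _ H (@cvg_gauss_fun R)).
Unshelve. all: by end_near. Qed.

Lemma continuous_gaM (h : R -> R) : continuous h -> continuous (fun t => h t * ga t).
Proof. by move=> ch; apply: continuous_fM => //; exact: continuous_gauss_fun. Qed.

Lemma integrable_gaM (h : R -> R) : continuous h -> (forall x, `|h x| <= 1) ->
  mu.-integrable [set: R] (EFin \o (fun t => h t * ga t)).
Proof.
move=> ch h1; apply: (@integrable_dominated _ (measurableTypeR R) _ mu _ ga).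
- by apply: measurable_continuous; exact: continuous_gaM.
- by move=> x; rewrite normrM (ger0_norm (expR_ge0 _)) ler_piMl// expR_ge0.
- exact: has_integral_gauss_fun.1.
Qed.

Lemma continuous_affine (a c : R) : continuous (fun t : R => a * t + c).
Proof.
apply: continuous_fD; last exact: continuous_fC.
by apply: continuous_fM; [exact: continuous_fC|exact: continuous_fid].
Qed.

Lemma continuous_cos_affine (a c : R) : continuous (fun t : R => cos (a * t + c)).
Proof. by move=> x; apply: continuous_comp; [exact: continuous_affine|exact: continuous_cos]. Qed.

Lemma continuous_sin_affine (a c : R) : continuous (fun t : R => sin (a * t + c)).
Proof. by move=> x; apply: continuous_comp; [exact: continuous_affine|exact: continuous_sin]. Qed.

(** Dominates the y-derivative of the integrand below; the square root makes it an affine rescaling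
    of [ga], whose integral is known. *)
Let G (t : R) := 2 * expR (- (Num.sqrt 2^-1 * t) ^+ 2).

Let GE t : G t = 2 * expR (- (t ^+ 2 / 2)).
Proof. by rewrite /G exprMn sqr_sqrtr//; congr (_ * expR _); field. Qed.

Let integrable_G : mu.-integrable [set: R] (EFin \o G).
Proof.
have s0 : 0 < Num.sqrt 2^-1 :> R by rewrite sqrtr_gt0.
have := has_integralZ 2 (has_integral_affine 0 s0 has_integral_gauss_fun).
move=> [+ _]; congr (_ .-integrable _ _); apply/funext => x /=.
by rewrite addr0.
Qed.

Let tga_le t : `|2 * t * ga t| <= G t.
Proof.
rewrite GE !normrM (ger0_norm (expR_ge0 _)) ger0_norm// -mulrA ler_pM2l//.
rewrite /ga (_ : - t ^+ 2 = - (t ^+ 2 / 2) + - (t ^+ 2 / 2)); last by field.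
rewrite expRD mulrA ler_piMl ?expR_ge0// expRN ler_pdivrMr ?expR_gt0// mul1r.
(* After exp x >= 1 + x, what remains is |t| <= 1 + t^2 / 2. *)
apply: le_trans (expR_ge1Dx _).
have -> : t ^+ 2 = `|t| ^+ 2 by rewrite real_normK// num_real.
set u := `|t|; nra.
Qed.

Let cont_tga : continuous (fun t : R => 2 * t * ga t).
Proof.
apply: continuous_gaM; apply: continuous_fM; [exact: continuous_fC|exact: continuous_fid].
Qed.

Let integrable_tgaM (h : R -> R) : continuous h -> (forall x, `|h x| <= 1) ->
  mu.-integrable [set: R] (EFin \o (fun t => 2 * t * ga t * h t)).
Proof.
move=> ch h1; apply: (@integrable_dominated _ (measurableTypeR R) _ mu _ G) => //.
- apply: measurable_continuous; apply: continuous_fM => //; exact: cont_tga.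
- by move=> x; rewrite normrM (le_trans _ (tga_le x))// ler_piMr.
Qed.

(** The Fourier transform of [ga] at y / pi, whose sine part vanishes by parity. It is computed from
    the equation I' = -2 y I. *)
Let I (y : R) := Rintegral mu [set: R] (fun t => cos (2 * y * t) * ga t).

Let cont_cos (y : R) : continuous (fun t : R => cos (2 * y * t)).
Proof.
by have := @continuous_cos_affine (2 * y) 0; under eq_fun do rewrite addr0.
Qed.

Let cont_sin (y : R) : continuous (fun t : R => sin (2 * y * t)).
Proof.
by have := @continuous_sin_affine (2 * y) 0; under eq_fun do rewrite addr0.
Qed.

Let I_has y : has_integral mu (fun t => cos (2 * y * t) * ga t) (I y).
Proof.
apply/integrable_has_integral/(@integrable_gaM (fun t => cos (2 * y * t))).
  exact: cont_cos.
by move=> x; exact: cos_max.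
Qed.

(** The derivative of [sin (2 * y * t) * ga t] integrates to 0 because this product vanishes at
    infinity. *)
Let by_parts y : has_integral mu (fun t => 2 * t * ga t * sin (2 * y * t)) (2 * y * I y).
Proof.
have H : has_integral mu (fun t => 2 * y * (cos (2 * y * t) * ga t) -
    2 * t * ga t * sin (2 * y * t)) 0.
  apply: (@has_integral_FTC _ _ (fun t => sin (2 * y * t) * ga t)).
  - apply: continuous_fB; apply: continuous_fM.
    + exact: continuous_fC.
    + exact/continuous_gaM/cont_cos.
    + exact: cont_tga.
    + exact: cont_sin.
  - move=> x; apply: is_derive_eq.
    rewrite /ga /GRing.scale /=; ring.
  - have H2 := integrable_has_integral (@integrable_tgaM (fun t => sin (2 * y * t))
      (@cont_sin y) (fun x => sin_max _)).
    exact: (has_integralB (has_integralZ (2 * y) (I_has y)) H2).1.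
  - have -> : (fun n : nat => sin (2 * y * n.+1%:R) * ga n.+1%:R -
       sin (2 * y * - n.+1%:R) * ga (- n.+1%:R)) =
       (fun n : nat => 2 * sin (2 * y * n.+1%:R) * ga n.+1%:R).
      by apply/funext => n; rewrite /ga mulrN sinN sqrrN; ring.
    apply/norm_cvg0P; apply: (@squeeze_cvgr _ _ _ _ (cst 0)
       (fun n => 2 * expR (- n.+1%:R ^+ 2))).
    + near=> n; rewrite normr_ge0/= !normrM ger0_norm//.
      rewrite (ger0_norm (expR_ge0 _)) -mulrA ler_pM2l// ler_piMl ?expR_ge0//.
      exact: sin_max.
    + exact: cvg_cst.
    + rewrite -[X in _ --> X](mulr0 2); apply: cvgM; first exact: cvg_cst.
      exact: cvg_gauss_nat.
have := has_integralB (has_integralZ (2 * y) (I_has y)) H.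
by apply: has_integral_eq => [x|]; ring.
Unshelve. all: by end_near. Qed.

Let I_derive (y : R) : is_derive y 1 I (- (2 * y * I y)).
Proof.
have dH (x t : R) : is_derive x 1 (fun u : R => cos (2 * u * t) * ga t) (- (2 * t * ga t * sin (2 * x * t))).
  by apply: is_derive_eq; rewrite /GRing.scale /=; ring.
have yI : `]y - 1, y + 1[%classic y by rewrite /= in_itv/=; lra.
have Hi x : `]y - 1, y + 1[%classic x ->
  mu.-integrable [set: R] (EFin \o (fun t => cos (2 * x * t) * ga t)).
  by move=> _; exact: (I_has x).1.
have Hd x t : `]y - 1, y + 1[%classic x -> [set: R] t ->
  derivable ((fun u t => cos (2 * u * t) * ga t) ^~ t) x 1.
  by move=> _ _; apply: ex_derive; exact: dH.
have Hp x t : (partial1of2 (fun u t => cos (2 * u * t) * ga t)) x t = - (2 * t * ga t * sin (2 * x * t)).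
  by rewrite partial1of2E; apply: derive_val; exact: dH.
have G0 t : 0 <= G t by rewrite mulr_ge0// expR_ge0.
have HG x t : `]y - 1, y + 1[%classic x -> [set: R] t ->
   `|(partial1of2 (fun u t => cos (2 * u * t) * ga t)) x t| <= G t.
  move=> _ _; rewrite Hp normrN normrM (le_trans _ (tga_le t))//.
  by rewrite ler_piMr// sin_max.
apply: DeriveDef.
  exact: (@derivable_under_integral R _ _ mu (fun u t => cos (2 * u * t) * ga t)
    setT measurableT y _ _ yI Hi Hd G G0 integrable_G HG).
have := @differentiation_under_integral R _ _ mu (fun u t => cos (2 * u * t) * ga t)
    setT measurableT y _ _ yI Hi Hd G G0 integrable_G HG.
rewrite derive1E => ->.
rewrite -mulN1r; have [_ <-] := has_integralZ (-1) (by_parts y).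
by apply: eq_Rintegral => t _; rewrite Hp mulN1r.
Qed.

(** The equation for [I] makes exp(y^2) I(y) constant, and its value at 0 is the Gauss integral. *)
Let IE y : I y = Num.sqrt pi * expR (- y ^+ 2).
Proof.
have D (x : R) : is_derive x 1 (fun x : R => expR (x ^+ 2) * I x) 0.
  have := I_derive x => H; apply: is_derive_eq.
  by rewrite /GRing.scale /=; ring.
have := @is_derive_0_is_cst _ (fun x : R => expR (x ^+ 2) * I x) 0 y D.
rewrite expr0n/= expR0 mul1r => E.
have I0 : I 0 = Num.sqrt pi.
  apply: (has_integral_uniq _ has_integral_gauss_fun).
  apply: has_integral_eq (I_has 0) => // x.
  by rewrite mulr0 mul0r cos0 mul1r.
by rewrite -I0 E mulrAC -expRD addrN expR0 mul1r.
Qed.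

Lemma gauss_fourier (l xi : R) : 0 < l ->
  has_integral mu (fun t => gauss l t * cos (2 * pi * xi * t))
    ((Num.sqrt l)^-1 * expR (- pi * (xi ^+ 2 / l))).
Proof.
move=> l0; have p0 := pi_gt0 R; set s := Num.sqrt (l * pi).
have s0 : 0 < s by rewrite sqrtr_gt0 mulr_gt0.
have s2 : s ^+ 2 = l * pi by rewrite sqr_sqrtr// mulr_ge0// ltW.
have := has_integral_affine 0 s0 (I_has (pi * xi / s)).
apply: has_integral_eq => [t|].
  rewrite addr0 mulrC; congr (_ * cos _).
    by rewrite /ga /gauss exprMn s2; congr expR; ring.
  by field; rewrite gt_eqF.
rewrite IE.
rewrite exprMn exprVn s2.
rewrite mulrAC; congr (_ * expR _).
  rewrite /s sqrtrM ?(ltW l0)//; field.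
  by rewrite !gt_eqF// sqrtr_gt0.
have l1 : l != 0 by rewrite gt_eqF.
have p1 : (pi : R) != 0 by rewrite gt_eqF.
move: p1; generalize (pi : R) => p p1.
by field; rewrite l1 p1.
Qed.

End gaussian.

(** * The Fejér kernel and the integral of sinc² *)

Section measurable_countable.
Variable R : realType.
Notation mu := (@lebesgue_measure R).

(** Every function on a countable set is measurable, since its preimages are countable. This treats
    the point 0 for the inverse and the nodes for the interpolants. *)
Lemma measurable_fun_off_countable (N : set R) (f : R -> R) : countable N ->
  measurable_fun (~` N : set (measurableTypeR R)) (f : measurableTypeR R -> R) ->
  measurable_fun [set: measurableTypeR R] (f : measurableTypeR R -> R).
Proof.
move=> cN mf.
have mC (B : set (measurableTypeR R)) : countable B -> measurable B.
  by apply: countable_measurable => t; exact: measurable_set1.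
have mN : measurable (N : set (measurableTypeR R)) := mC _ cN.
have mfN : measurable_fun (N : set (measurableTypeR R)) (f : measurableTypeR R -> R).
  move=> _ B mB; apply: mC; apply: (sub_countable _ cN).
  by apply: subset_card_le => x [].
rewrite -(setUv (N : set (measurableTypeR R))).
by apply/(measurable_funU f mN (measurableC mN)); split.
Qed.

Lemma measurable_invr : measurable_fun [set: measurableTypeR R] (fun x : measurableTypeR R => (x : R)^-1).
Proof.
apply: (@measurable_fun_off_countable [set 0]).
  exact/finite_set_countable/finite_set1.
apply: open_continuous_measurable_fun.
  by apply: closed_openC; exact: closed_eq.
by move=> x; rewrite inE /= => /eqP x0; apply: inv_continuous.
Qed.

End measurable_countable.

Section trigonometry.
Variable R : realType.
Implicit Types x y t u : R.

Lemma MVT_between (f df : R -> R) x y : (forall z : R, is_derive z 1 f (df z)) ->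
  exists2 c, (Num.min x y <= c <= Num.max x y) & f y - f x = df c * (y - x).
Proof.
move=> dF; have cf := is_derive_continuous dF.
have [xy|/ltW yx] := leP x y.
  have [|c cxy E] := @MVT_segment _ f df x y xy (fun z _ => dF z).
    exact: continuous_subspaceT.
  by exists c.
have [|c cxy E] := @MVT_segment _ f df y x yx (fun z _ => dF z).
  exact: continuous_subspaceT.
by exists c => //; rewrite -opprB E -mulrN opprB.
Qed.

Lemma sin_norm_le x : `|sin x| <= `|x|.
Proof.
have [c _] := @MVT_between sin cos 0 x (fun z => is_derive_sin z).
rewrite sin0 !subr0 => ->; rewrite normrM ler_piMl//; exact: cos_max.
Qed.

(** Two mean value steps: |cos c - 1| <= |c| and |c| <= |x|. The quadratic error suffices for n
    sin(a / n) --> a. *)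
Lemma sin_sub_id_le x : `|sin x - x| <= x ^+ 2.
Proof.
have d1 (z : R) : is_derive z 1 (fun z => sin z - z) (cos z - 1).
  by apply: is_derive_eq.
have [c cx] := @MVT_between _ _ 0 x d1.
rewrite sin0 !subr0 => ->.
have cle : `|c| <= `|x|.
  move: cx; case: (leP 0 x) => x0 /andP[c1 c2].
    by rewrite !ger0_norm.
  by rewrite !ler0_norm ?lerN2// ltW.
have [e _] := @MVT_between cos (fun z => - sin z) 0 c (fun z => is_derive_cos z).
rewrite cos0 subr0 => ->.
rewrite normrM normrM normrN -real_normK ?num_real// expr2 ler_wpM2r//.
by rewrite (le_trans _ cle)// ler_piMl// sin_max.
Qed.

(** By the mean value theorem sin(x / 2) >= (x / 2) cos(x / 2), so sin x >= x cos(x / 2)^2, and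
    cos(x / 2)^2 >= 1/2 because cos x >= 0. *)
Lemma sin_ge_half x : 0 <= x <= pi / 2 -> x / 2 <= sin x.
Proof.
move=> /andP[x0 xpi].
have p0 := pi_gt0 R.
have y0 : 0 <= x / 2 by rewrite divr_ge0.
have [c /andP[c0 cx]] := @MVT_between sin cos 0 (x / 2) (fun z => is_derive_sin z).
rewrite min_l// in c0; rewrite max_r// in cx.
rewrite sin0 !subr0 => sE.
have le1 : cos (x / 2) <= cos c.
  move: cx; rewrite le_eqVlt => /predU1P[->//|cx].
  by apply/ltW; rewrite ltr_cos// in_itv/=; move: p0 xpi c0 cx x0; generalize (pi : R) => p; lra.
have ce0 : 0 <= cos (x / 2).
  by apply: cos_ge0_pihalf; move: p0 xpi x0; generalize (pi : R) => p; lra.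
have xE : x = (x / 2) *+ 2 by rewrite -mulr_natl mulrCA divff ?mulr1.
have -> : sin x = 2 * (sin (x / 2) * cos (x / 2)).
  by rewrite {1}xE sin_mulr2n -mulr_natl [cos _ * _]mulrC.
have cx0 : 0 <= cos x.
  by apply: cos_ge0_pihalf; move: p0 xpi x0; generalize (pi : R) => p; lra.
have cE : cos x = 2 * cos (x / 2) ^+ 2 - 1.
  by rewrite {1}xE cos_mulr2n -mulr_natl.
rewrite sE; set C := cos (x / 2) in le1 ce0 cE *.
have : C * C <= cos c * C by rewrite ler_wpM2r.
nra.
Qed.

Lemma sin_pi_lower t : `|t| <= 2^-1 -> t ^+ 2 <= sin (pi * t) ^+ 2.
Proof.
move=> t2; have p2 := pi_ge2 R; have p0 := pi_gt0 R.
have H : `|t| <= sin (pi * `|t|).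
  apply: le_trans (sin_ge_half _); last first.
    rewrite mulr_ge0 ?(ltW p0)//=; move: t2 p0; generalize (pi : R) => p t2 p0.
    by rewrite ler_wpM2l// ltW.
  by have := normr_ge0 t; move: p2; generalize (pi : R) => p; nra.
have -> : sin (pi * t) ^+ 2 = sin (pi * `|t|) ^+ 2.
  case: (leP 0 t) => t0; first by rewrite ger0_norm.
  by rewrite ltr0_norm// mulrN sinN sqrrN.
by rewrite -[t ^+ 2]real_normK ?num_real// lerXn2r// nnegrE// (le_trans _ H).
Qed.

Lemma sin_pi_nat n : sin (pi * n%:R) = 0 :> R.
Proof.
elim: n => [|n IH]; first by rewrite mulr0 sin0.
by rewrite -natr1 mulrDr mulr1 sinDpi IH oppr0.
Qed.

Lemma cos_pi_nat n : cos (pi * n%:R) = (-1) ^+ n :> R.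
Proof.
elim: n => [|n IH]; first by rewrite mulr0 cos0.
by rewrite -natr1 mulrDr mulr1 cosDpi IH exprS mulN1r.
Qed.

Lemma sin_pi_natB k l : sin (pi * (k%:R - l%:R)) = 0 :> R.
Proof. by rewrite mulrBr sinB !sin_pi_nat mul0r mulr0 subr0. Qed.

Lemma sin_eq0_itv x : - pi < x < pi -> x != 0 -> sin x != 0.
Proof.
move=> /andP[x1 x2] x0; case: (ltgtP x 0) x0 => // x0 _.
  rewrite -oppr_eq0 -sinN gt_eqF// sin_gt0_pi// oppr_gt0 x0/=.
  by rewrite ltrNl.
by rewrite gt_eqF// sin_gt0_pi// x0.
Qed.

Lemma cvg_inv_nat (c : R) : c / n.+1%:R @[n --> \oo] --> (0 : R).
Proof.
rewrite -[X in _ --> X](mulr0 c); apply: cvgM; first exact: cvg_cst.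
exact: cvg_harmonic.
Qed.

End trigonometry.

Section fejer_kernel.
Variable R : realType.
Notation mu := (@lebesgue_measure R).

(** Passing from N to N + 1 adds one row and one column, that is c 0 + 2 (c 1 + ... + c N). Divided
    by N, the double sum is thus the Cesàro mean of the symmetric partial sums. *)
Lemma sum_differences (c : R -> R) N : (forall x, c (- x) = c x) ->
  \sum_(k < N) \sum_(l < N) c (k%:R - l%:R) =
  \sum_(m < N) (c 0 + 2 * \sum_(i < m) c i.+1%:R).
Proof.
move=> ce; elim: N => [|N IH]; first by rewrite !big_ord0.
rewrite [RHS]big_ord_recr/= -IH big_ord_recr/=.
under eq_bigr do rewrite big_ord_recr/=.
rewrite big_split/= -addrA; congr (_ + _).
rewrite [X in _ + X]big_ord_recr/= subrr.
have -> : \sum_(i < N) c (i%:R - N%:R) = \sum_(i < N) c i.+1%:R.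
  rewrite [RHS](reindex_inj rev_ord_inj)/=; apply: eq_bigr => i _.
  rewrite -ce opprB -natrB ?(ltnW (ltn_ord i))//.
  by rewrite subnSK.
have -> : \sum_(i < N) c (N%:R - i%:R) = \sum_(i < N) c i.+1%:R.
  rewrite [RHS](reindex_inj rev_ord_inj)/=; apply: eq_bigr => i _.
  rewrite -natrB ?(ltnW (ltn_ord i))//.
  by rewrite subnSK.
ring.
Qed.

(** This is |sum_{k < N} exp(2 pi i k t)|^2 / N. The double sum makes positivity, termwise
    integration and the expansion of products over coordinates direct. *)
Definition fejer N (t : R) : R :=
  N%:R^-1 * \sum_(k < N) \sum_(l < N) cos (2 * pi * (k%:R - l%:R) * t).

Lemma fejer_ge0 N t : 0 <= fejer N t.
Proof.
rewrite mulr_ge0// ?invr_ge0//.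
suff -> : \sum_(k < N) \sum_(l < N) cos (2 * pi * (k%:R - l%:R) * t) =
  (\sum_(k < N) cos (2 * pi * k%:R * t)) ^+ 2 + (\sum_(k < N) sin (2 * pi * k%:R * t)) ^+ 2.
  by rewrite addr_ge0 ?sqr_ge0.
rewrite !expr2 !mulr_suml -big_split/=; apply: eq_bigr => k _.
rewrite !mulr_sumr -big_split/=; apply: eq_bigr => l _.
by rewrite -cosB; congr cos; ring.
Qed.

Lemma fejer_le N t : fejer N t <= N%:R.
Proof.
case: N => [|N]; first by rewrite /fejer invr0 mul0r.
rewrite /fejer ler_pdivrMl// -natrM.
have -> : (N.+1 * N.+1)%:R = \sum_(k < N.+1) \sum_(l < N.+1) (1 : R).
  by rewrite !sumr_const !card_ord -mulrnA.
by apply: ler_sum => k _; apply: ler_sum => l _; exact: cos_le1.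
Qed.

Lemma fejerD1 N t : fejer N (t + 1) = fejer N t.
Proof.
congr (_ * _); apply: eq_bigr => k _; apply: eq_bigr => l _.
rewrite mulrDr mulr1 cosD.
have -> : sin (2 * pi * (k%:R - l%:R)) = 0 :> R.
  have := @sin_pi_natB R (2 * k) (2 * l); rewrite !natrM -mulrBr => <-.
  by congr sin; ring.
have -> : cos (2 * pi * (k%:R - l%:R)) = 1 :> R.
  have -> : 2 * pi * (k%:R - l%:R) = (pi * (k%:R - l%:R)) *+ 2 :> R.
    by ring.
  by rewrite cos_mulr2n -mulr_natl cos2sin2 sin_pi_natB expr0n/= subr0; ring.
by rewrite mulr1 mulr0 subr0.
Qed.

Lemma fejerDn N t n : fejer N (t + n%:R) = fejer N t.
Proof.
elim: n => [|n IH]; first by rewrite addr0.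
by rewrite -natr1 addrA fejerD1.
Qed.

Lemma fejerBn N t n : fejer N (t - n%:R) = fejer N t.
Proof. by rewrite -(fejerDn N _ n) subrK. Qed.

(** The closed form of the kernel, with the denominator multiplied out so that it also holds at
    integers. The induction telescopes: sin((2N + 1) a) sin a = sin^2((N + 1) a) - sin^2(N a). *)
Lemma fejer_sin N t : fejer N t * sin (pi * t) ^+ 2 = N%:R^-1 * sin (N%:R * (pi * t)) ^+ 2.
Proof.
rewrite /fejer -mulrA; congr (_ * _).
rewrite (@sum_differences (fun x => cos (2 * pi * x * t))); last first.
  by move=> x; rewrite mulrN mulNr cosN.
rewrite mulr0 mul0r cos0; set a := pi * t.
(* Closed form of the Dirichlet kernel. *)
have D m : (1 + 2 * \sum_(i < m) cos (2 * pi * i.+1%:R * t)) * sin a = sin ((2 * m + 1)%:R * a).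
  elim: m => [|m IH]; first by rewrite big_ord0 mulr0 addr0 muln0 !mul1r.
  rewrite big_ord_recr/= mulrDr addrA mulrDl {}IH.
  have -> : 2 * pi * m.+1%:R * t = (2 * m + 1)%:R * a + a.
    by rewrite natrD natrM -natr1 /a; ring.
  have -> : (2 * m.+1 + 1)%:R * a = (2 * m + 1)%:R * a + a + a.
    by rewrite !natrD !natrM -natr1 /a; ring.
  set b := _ * a; rewrite [in RHS]sinD (_ : sin b = sin (b + a - a)); last by congr sin; ring.
  rewrite sinB; ring.
elim: N => [|N IH]; first by rewrite big_ord0 !mul0r sin0 expr0n.
rewrite big_ord_recr/= mulrDl IH [sin a ^+ 2]expr2 mulrA D.
have -> : (2 * N + 1)%:R * a = N.+1%:R * a + N%:R * a by rewrite natrD natrM -natr1; ring.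
have -> : sin a = sin (N.+1%:R * a - N%:R * a) by congr sin; rewrite -natr1; ring.
rewrite sinD sinB; set A := N.+1%:R * a; set B := N%:R * a.
have := cos2Dsin2 A; have := cos2Dsin2 B.
move: (cos A) (sin A) (cos B) (sin B) => ca sa cb sb E1 E2.
have F1 : cb ^+ 2 = 1 - sb ^+ 2 by rewrite -E1; ring.
have F2 : ca ^+ 2 = 1 - sa ^+ 2 by rewrite -E2; ring.
have -> : (sa * cb + ca * sb) * (sa * cb - ca * sb) = sa ^+ 2 * cb ^+ 2 - ca ^+ 2 * sb ^+ 2 by ring.
rewrite F1 F2; ring.
Qed.

(** Quantitative concentration at 0: it dominates the rescaled kernels in the passage to sinc² and
    controls the approximate identity in Poisson summation. *)
Lemma fejer_sqr_le N t : `|t| <= 2^-1 -> t ^+ 2 * fejer N t <= N%:R^-1.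
Proof.
move=> /sin_pi_lower H.
apply: (@le_trans _ _ (fejer N t * sin (pi * t) ^+ 2)).
  by rewrite mulrC ler_wpM2l// fejer_ge0.
by rewrite fejer_sin ler_piMr ?invr_ge0// sin2cos2 gerBl sqr_ge0.
Qed.

(** Half-open, so that its integer translates tile the line. *)
Definition unit_window : R -> R := \1_(`[(- 2^-1), 2^-1[%classic).

Lemma unit_windowE t : unit_window t = ((- 2^-1 <= t) && (t < 2^-1))%:R.
Proof. by rewrite /unit_window indicE mem_setE in_itv. Qed.

Lemma unit_window_le t : 0 <= unit_window t <= 1.
Proof. by rewrite unit_windowE ler0n lern1 leq_b1. Qed.

Lemma unit_window_supp t : 2^-1 < `|t| -> unit_window t = 0.
Proof.
move=> t2; rewrite unit_windowE; case: andP => // -[a b].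
by move: t2; rewrite ltNge ler_norml a ltW.
Qed.

Lemma has_integral_fejer N : has_integral mu (fun t => fejer N.+1 t * unit_window t) 1.
Proof.
have n0 : N.+1%:R != 0 :> R by rewrite pnatr_eq0.
have H k l : has_integral mu (fun t => cos (2 * pi * (k%:R - l%:R) * t) * unit_window t) ((k == l)%:R).
  have h : - 2^-1 < 2^-1 :> R by lra.
  have [->|kl] := eqVneq k l.
    have := @has_integral_itv R (fun=> 1) (fun x => x) _ _ h (@continuous_fC R 1)
      (fun x => is_derive_id x 1).
    apply: has_integral_eq => [x|]; last by rewrite /=; lra.
    by rewrite subrr mulr0 mul0r cos0.
  set w := 2 * pi * (k%:R - l%:R).
  have w0 : w != 0.
    apply: mulf_neq0; last by rewrite subr_eq0 eqr_nat.
    by rewrite mulf_neq0// gt_eqF// pi_gt0.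
  have cc : continuous (fun t => cos (w * t)).
    by have := @continuous_cos_affine R w 0; under eq_fun do rewrite addr0.
  have := @has_integral_itv R (fun t => cos (w * t)) (fun t => w^-1 * sin (w * t)) _ _ h cc.
  case=> [x|I E].
    apply: is_derive_eq; rewrite /GRing.scale /=; field; exact: w0.
  split=> //; rewrite E mulrN sinN.
  have -> : w / 2 = pi * (k%:R - l%:R) by rewrite /w; field.
  by rewrite sin_pi_natB oppr0 !mulr0 subr0.
have := has_integralZ (N.+1%:R^-1) (has_integral_sum (index_enum 'I_N.+1)
  (fun k : 'I_N.+1 => has_integral_sum (index_enum 'I_N.+1) (fun l : 'I_N.+1 => H k l))).
apply: has_integral_eq => [x|].
  by rewrite /fejer -mulrA mulr_suml; congr (_ * _); apply: eq_bigr => k _; rewrite mulr_suml.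
rewrite (eq_bigr (fun=> 1)) => [|k _].
  by rewrite sumr_const card_ord mulVf.
rewrite (bigD1 k)//= eqxx big1 ?addr0// => l lk.
by rewrite eq_sym (negbTE lk : (val l == val k) = false).
Qed.

(** At 0 the convention on division gives the value 0 instead of 1, so the convergence to [sincsq]
    below is asserted away from 0. *)
Definition sincsq (u : R) := (sin (pi * u) / (pi * u)) ^+ 2.

Lemma measurable_sincsq : measurable_fun [set: measurableTypeR R] (sincsq : measurableTypeR R -> R).
Proof.
apply: measurable_funX; apply: measurable_funM.
  apply: measurable_continuous; have := @continuous_sin_affine R pi 0.
  by under eq_fun do rewrite addr0.
apply: (measurableT_comp (@measurable_invr R)).
by apply: measurable_funM => //.
Qed.

Lemma sincsq_le u : 0 <= sincsq u <= 2 * (1 + u ^+ 2)^-1.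
Proof.
rewrite sqr_ge0/=.
have p2 := pi_ge2 R.
have [->|u0] := eqVneq u 0.
  by rewrite /sincsq mulr0 sin0 mul0r expr0n/= addr0 invr1 mulr1.
have u2 : 0 < u ^+ 2 by rewrite exprn_even_gt0.
have p0 : 0 < (pi : R) ^+ 2 by rewrite exprn_even_gt0//= gt_eqF// pi_gt0.
have D0 : 0 < 1 + u ^+ 2 by rewrite ltr_wpDr ?sqr_ge0.
rewrite ler_pdivlMr//.
have A : sincsq u <= 1.
  rewrite /sincsq -real_normK ?num_real// expr_le1// normrM normfV ler_pdivrMr ?mul1r ?sin_norm_le//.
  by rewrite normr_gt0 mulf_neq0// gt_eqF// pi_gt0.
have B : sincsq u * u ^+ 2 <= 1.
  have E (s p v : R) : v != 0 -> s / (p * v) * v = s / p.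
    by move=> v0; rewrite invfM mulrA mulfVK.
  rewrite /sincsq expr_div_n exprMn E ?gt_eqF//.
  rewrite ler_pdivrMr// mul1r (@le_trans _ _ 1)//.
  by move: p2; generalize (pi : R) => p; nra.
rewrite mulrDr mulr1; lra.
Qed.

(** One period of the kernel, stretched by N + 1 and normalised. At a fixed nonzero u and for large
    N it equals sin^2(pi u) / ((N + 1) sin(pi u / (N + 1)))^2, which tends to sinc². *)
Let psi N (u : R) := N.+1%:R^-1 * (fejer N.+1 (u / N.+1%:R) * unit_window (u / N.+1%:R)).

Let psi_int N : has_integral mu (psi N) 1.
Proof.
have n0 : 0 < N.+1%:R^-1 :> R by rewrite invr_gt0 ltr0n.
have := has_integralZ (N.+1%:R^-1) (has_integral_affine 0 n0 (has_integral_fejer N)).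
apply: has_integral_eq => [x|]; first by rewrite addr0 /psi [_^-1 * x]mulrC.
by rewrite mulrA mulr1 divff// gt_eqF.
Qed.

Let psi_le N u : `|psi N u| <= 2 * (1 + u ^+ 2)^-1.
Proof.
have n0 : 0 < N.+1%:R :> R by rewrite ltr0n.
have /andP[w0 w1] := unit_window_le (u / N.+1%:R).
rewrite ger0_norm; last first.
  by apply: mulr_ge0; [rewrite invr_ge0|apply: mulr_ge0 => //; exact: fejer_ge0].
have D0 : 0 < 1 + u ^+ 2 by rewrite ltr_wpDr ?sqr_ge0.
rewrite ler_pdivlMr//.
have [h|h] := leP `|u / N.+1%:R| 2^-1; last first.
  by rewrite /psi unit_window_supp// !mulr0 mul0r.
apply: (@le_trans _ _ (N.+1%:R^-1 * fejer N.+1 (u / N.+1%:R) * (1 + u ^+ 2))).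
  rewrite ler_pM2r// /psi ler_pM2l ?invr_gt0// ler_piMr// fejer_ge0//.
(* The two summands of 1 + u^2 are bounded separately: the kernel is at most N + 1, and u^2 times it
   falls under [fejer_sqr_le]. *)
rewrite mulrDr mulr1 (_ : 2 = 1 + 1)//; apply: lerD.
  by rewrite ler_pdivrMl// mulr1 fejer_le.
have := fejer_sqr_le N.+1 h.
rewrite expr_div_n mulrAC ler_pdivrMr ?exprn_gt0//.
rewrite expr2 mulKf ?gt_eqF// => H.
by rewrite -mulrA ler_pdivrMl// mulr1 mulrC.
Qed.

Let psi_cvg u : u != 0 -> psi n u @[n --> \oo] --> sincsq u.
Proof.
move=> u0; set a := pi * u.
have p0 := pi_gt0 R.
have a0 : a != 0 by rewrite mulf_neq0// gt_eqF.
have L : n.+1%:R * sin (a / n.+1%:R) @[n --> \oo] --> a.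
  have E : a ^+ 2 / n.+1%:R @[n --> \oo] --> (0 : R) by exact: cvg_inv_nat.
  apply/cvgrPdistC_le => e e0.
  move/cvgrPdistC_le : E => /(_ _ e0); apply: filterS => n.
  rewrite subr0 ger0_norm ?divr_ge0 ?sqr_ge0//; apply: le_trans.
  have n0 : 0 < n.+1%:R :> R by rewrite ltr0n.
  have -> : n.+1%:R * sin (a / n.+1%:R) - a = n.+1%:R * (sin (a / n.+1%:R) - a / n.+1%:R).
    by field; rewrite gt_eqF.
  rewrite normrM (ger0_norm (ltW n0)) mulrC -ler_pdivlMr//.
  apply: (le_trans (sin_sub_id_le _)).
  by rewrite expr_div_n [X in _ / X]expr2 invfM mulrA.
have : sin a ^+ 2 / (n.+1%:R * sin (a / n.+1%:R) * (n.+1%:R * sin (a / n.+1%:R)))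
    @[n --> \oo] --> sin a ^+ 2 / (a * a).
  apply: cvgM; first exact: cvg_cst.
  by apply: cvgV; [rewrite mulf_neq0|exact: cvgM].
rewrite -expr2 -expr_div_n; apply: cvg_trans; apply: near_eq_cvg; near=> n.
have n0 : 0 < n.+1%:R :> R by rewrite ltr0n.
have hu : `|u / n.+1%:R| < 2^-1.
  near: n; have := cvg_inv_nat u => /cvgr0Pnorm_lt; apply.
  by rewrite invr_gt0.
have ha : `|a / n.+1%:R| < pi.
  near: n; have := cvg_inv_nat a => /cvgr0Pnorm_lt; apply.
  exact: pi_gt0.
have s0 : sin (a / n.+1%:R) != 0.
  apply: sin_eq0_itv; first by rewrite -ltr_norml.
  by rewrite mulf_neq0// invr_neq0// gt_eqF.
have w1 : unit_window (u / n.+1%:R) = 1.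
  by rewrite unit_windowE; move: hu; rewrite ltr_norml => /andP[/ltW -> ->].
rewrite -expr2 /psi w1 mulr1 exprMn invfM mulrA.
have := fejer_sin n.+1 (u / n.+1%:R).
have -> : pi * (u / n.+1%:R) = a / n.+1%:R by rewrite mulrA.
rewrite [n.+1%:R * (a / _)]mulrC divfK ?gt_eqF// => E.
apply: (mulIf (expf_neq0 2 s0)); rewrite -[RHS]mulrA E.
rewrite divfK ?expf_neq0// expr2 invfM.
ring.
Unshelve. all: by end_near. Qed.

Theorem has_integral_sincsq : has_integral mu sincsq 1.
Proof.
have [] := @has_integral_dct _ _ _ mu [set 0] psi (fun=> 1) sincsq
  (fun u => 2 * (1 + u ^+ 2)^-1).
- exact: measurable_set1.
- exact: lebesgue_measure_set1.
- exact: psi_int.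
- exact: measurable_sincsq.
- by move=> x /eqP; exact: psi_cvg.
- by move=> n x _; exact: psi_le.
- exact: (has_integralZ 2 (integrable_has_integral (integrable_oneDsqrV R))).1.
move=> [I _] L; split => //.
apply: cvg_unique L _; first exact: Rhausdorff.
exact: cvg_cst.
Qed.

End fejer_kernel.

(** * Theta series and Poisson summation for Gaussians *)

Section series_bounds.
Variable R : realType.
Implicit Types (u v : nat -> R) (C K : R).

Definition invsq (n : nat) : R := (n.+1%:R ^+ 2)^-1.

Lemma invsq_gt0 n : 0 < invsq n.
Proof. by rewrite invr_gt0 exprn_gt0// ltr0n. Qed.

Lemma sum_invsq_le M : \sum_(n < M) invsq n <= 2.
Proof.
(* The strengthening that survives induction: 1 / (M + 1)^2 <= 2 / (M + 1) - 2 / (M + 2). *)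
suff : \sum_(n < M) invsq n <= 2 - 2 / M.+1%:R.
  by move/le_trans; apply; rewrite gerBl divr_ge0.
elim: M => [|M IH]; first by rewrite big_ord0 divr1 subrr.
rewrite big_ord_recr/=; apply: (le_trans (lerD IH (lexx _))).
rewrite -subr_ge0 /invsq -[M.+2%:R]natr1.
have : 1 <= M.+1%:R :> R by rewrite ler1n.
move: (M.+1%:R : R) => x x1.
have -> : 2 - 2 / (x + 1) - (2 - 2 / x + (x ^+ 2)^-1) = (x - 1) / (x ^+ 2 * (x + 1)).
  by field; apply/andP; split; lra.
by apply: divr_ge0; [lra|rewrite mulr_ge0 ?sqr_ge0//; lra].
Qed.

Lemma cvg_series_invsq_dom u C : (forall n, `|u n| <= C * invsq n) -> cvgn (series u).
Proof.
move=> uC; apply: normed_cvg; apply: nondecreasing_is_cvgn.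
  by apply/nondecreasing_seqP => n; rewrite -[leRHS]/(series (fun k => `|u k|) n.+1) seriesSr lerDl.
have C0 : 0 <= C.
  have := le_trans (normr_ge0 _) (uC 0%N).
  by rewrite pmulr_lge0// invsq_gt0.
exists (C * 2) => _ [M _ <-].
rewrite (_ : [normed series u] M = \sum_(n < M) `|u n|); last exact: big_mkord.
apply: (@le_trans _ _ (\sum_(n < M) C * invsq n)); first by apply: ler_sum.
by rewrite -mulr_sumr ler_wpM2l// sum_invsq_le.
Qed.

Lemma cvg_dist_le u v a b K : u n @[n --> \oo] --> a -> v n @[n --> \oo] --> b ->
  (forall n, `|u n - v n| <= K) -> `|a - b| <= K.
Proof.
move=> ua vb uv; have H : `|u n - v n| @[n --> \oo] --> `|a - b| by apply: cvg_norm; exact: cvgB.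
rewrite -(cvg_lim _ H)//; apply: limr_le; first by apply/cvg_ex; eexists; exact: H.
exact: nearW.
Qed.

End series_bounds.

Section gauss_bounds.
Variables (R : realType) (delta : R).
Hypothesis delta_gt0 : 0 < delta.

Lemma gauss_gt0 y : 0 < gauss delta y. Proof. exact: expR_gt0. Qed.

Lemma gaussN y : gauss delta (- y) = gauss delta y.
Proof. by rewrite /gauss sqrrN. Qed.

Lemma gauss_le1 y : gauss delta y <= 1.
Proof.
by rewrite /gauss -expR0 ler_expR !mulNr oppr_le0 mulr_ge0 ?sqr_ge0// mulr_ge0 ?pi_ge0// ltW.
Qed.

Lemma is_derive_gauss (y : R) :
  is_derive y 1 (gauss delta) (- (2 * delta * pi) * y * gauss delta y).
Proof. by apply: is_derive_eq; rewrite /gauss /GRing.scale /=; ring. Qed.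

Lemma continuous_gauss : continuous (gauss delta).
Proof. exact: is_derive_continuous is_derive_gauss. Qed.

(** The power 4 is a budget: the derivative costs one factor 1 + y^2, the size of a node a second,
    the translation of the sinc bounds a third, and the last makes sums over the nodes converge. It
    is the fourth power of exp x >= 1 + x. *)
Lemma gauss_decay : exists2 C, 0 < C & forall y, gauss delta y <= C / (1 + y ^+ 2) ^+ 4.
Proof.
have p0 := pi_gt0 R.
pose k := Num.min 1 (delta * pi / 4).
have k0 : 0 < k by rewrite lt_min ltr01 divr_gt0// mulr_gt0.
exists (k ^+ 4)^-1 => [|y]; first by rewrite invr_gt0 exprn_gt0.
have y0 : 0 < 1 + y ^+ 2 by rewrite ltr_wpDr ?sqr_ge0.
have H : k * (1 + y ^+ 2) <= expR (delta * pi / 4 * y ^+ 2).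
  apply: le_trans (expR_ge1Dx _).
  rewrite mulrDr mulr1 lerD//; first by rewrite ge_min lexx.
  by rewrite ler_wpM2r ?sqr_ge0// ge_min lexx orbT.
have -> : gauss delta y = (expR (delta * pi / 4 * y ^+ 2) ^+ 4)^-1.
  rewrite -expRM_natl -expRN /gauss; congr expR; by field.
rewrite -invfM -exprMn lef_pV2 ?posrE ?exprn_gt0 ?expR_gt0 ?mulr_gt0//.
by rewrite lerXn2r// nnegrE ?expR_ge0// mulr_ge0// ltW.
Qed.

Lemma gauss_derive_decay : exists2 C, 0 < C &
  forall y, `|(2 * delta * pi) * y * gauss delta y| <= C / (1 + y ^+ 2) ^+ 3.
Proof.
have [C C0 HC] := gauss_decay; have p0 := pi_gt0 R.
have d0 : 0 < 2 * delta * pi by rewrite !mulr_gt0.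
exists (2 * delta * pi * C); first by rewrite mulr_gt0.
move=> y; have y0 : 0 < 1 + y ^+ 2 by rewrite ltr_wpDr ?sqr_ge0.
set D := 2 * delta * pi in d0 *; clearbody D.
rewrite normrM (ger0_norm (ltW (gauss_gt0 y))) normrM (ger0_norm (ltW d0)) -!mulrA ler_pM2l//.
apply: (le_trans (ler_wpM2l (normr_ge0 y) (HC y))).
rewrite mulrCA ler_pM2l// [_ ^+ 4]exprS invfM mulrA -[leRHS]mul1r.
rewrite ler_wpM2r ?invr_ge0 ?exprn_ge0 ?(ltW y0)// ler_pdivrMr// mul1r.
rewrite -real_normK ?num_real//.
have : 0 <= (`|y| - 1) ^+ 2 by rewrite sqr_ge0.
have := normr_ge0 y; nra.
Qed.

End gauss_bounds.

Section theta.
Variable R : realType.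
Notation mu := (@lebesgue_measure R).

Definition theta_term (g : R) (e : nat) (x : R) : R :=
  expR (- pi * (g * x ^+ 2)) * cos (pi * x * e%:R).

(** Theta(e / 2; i g), folded by the symmetry n --> -n. *)
Definition theta (g : R) (e : nat) : R :=
  1 + 2 * limn (series (fun n => theta_term g e n.+1%:R)).

Lemma theta_termN g e x : theta_term g e (- x) = theta_term g e x.
Proof.
rewrite /theta_term sqrrN; congr (_ * _); rewrite -[RHS]cosN; congr cos; ring.
Qed.

Lemma theta_term0 g e : theta_term g e 0 = 1.
Proof. by rewrite /theta_term expr0n/= !mulr0 mul0r cos0 expR0 mulr1. Qed.

Lemma theta_term_le g e : 0 < g ->
  exists C, forall n, `|theta_term g e n.+1%:R| <= C * invsq R n.
Proof.
move=> g0; have [C C0 H] := gauss_decay g0; exists C => n.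
have y1 : 0 < n.+1%:R ^+ 2 :> R by rewrite exprn_gt0// ltr0n.
rewrite /theta_term normrM (ger0_norm (expR_ge0 _)).
apply: (@le_trans _ _ (gauss g n.+1%:R)).
  rewrite /gauss (_ : - g * pi * n.+1%:R ^+ 2 = - pi * (g * n.+1%:R ^+ 2)); last by ring.
  by rewrite ler_piMr ?expR_ge0// cos_max.
apply: (le_trans (H _)); have D0 : 0 < 1 + n.+1%:R ^+ 2 :> R by rewrite ltr_wpDr ?sqr_ge0.
rewrite ler_pM2l// /invsq lef_pV2 ?posrE ?exprn_gt0//.
apply: (@le_trans _ _ (1 + n.+1%:R ^+ 2)); first by rewrite lerDr.
by rewrite ler_eXnr// lerDl ltW.
Qed.

Lemma cvg_theta g e : 0 < g -> cvgn (series (fun n => theta_term g e n.+1%:R)).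
Proof. by move=> /(theta_term_le e)[C]; exact: cvg_series_invsq_dom. Qed.

(** The Cesàro means of [theta], in the double-sum form that Fejér kernels produce. *)
Definition theta_mean g e N : R :=
  N%:R^-1 * \sum_(k < N) \sum_(l < N) theta_term g e (k%:R - l%:R).

Lemma cvg_theta_mean g e : 0 < g -> theta_mean g e n.+1 @[n --> \oo] --> theta g e.
Proof.
move=> g0.
pose u m := 1 + 2 * series (fun n => theta_term g e n.+1%:R) m.
have uc : u m @[m --> \oo] --> theta g e.
  by apply: cvgD; [exact: cvg_cst|apply: cvgM; [exact: cvg_cst|exact: cvg_theta]].
have := cesaro uc; apply: cvg_trans; apply: near_eq_cvg; apply: nearW => n.
rewrite /arithmetic_mean /= /theta_mean; congr (_ * _).
rewrite (sum_differences _ (theta_termN g e)) theta_term0 /series/= big_mkord.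
by apply: eq_bigr => m _; rewrite /u /series/= big_mkord.
Qed.

Lemma gauss_fejer (l a : R) e N : 0 < l ->
  has_integral mu (fun t => gauss l t * fejer N (a * t - e%:R / 2))
    ((Num.sqrt l)^-1 * theta_mean (a ^+ 2 / l) e N).
Proof.
move=> l0.
have H (k m : nat) : has_integral mu (fun t => gauss l t * cos (2 * pi * (k%:R - m%:R) * (a * t - e%:R / 2)))
   ((Num.sqrt l)^-1 * theta_term (a ^+ 2 / l) e (k%:R - m%:R)).
  have := has_integralZ (cos (pi * (k%:R - m%:R) * e%:R)) (gauss_fourier (a * (k%:R - m%:R)) l0).
  apply: has_integral_eq => [t|].
    rewrite mulrCA; congr (_ * _).
    have -> : 2 * pi * (k%:R - m%:R) * (a * t - e%:R / 2) =
       2 * pi * (a * (k%:R - m%:R)) * t - pi * (k%:R - m%:R) * e%:R.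
      by move: (pi : R) => p; field.
    (* The number (k - m) e is an integer, so this phase has sine 0 and splits off as a cosine
       factor. *)
    have s0 : sin (pi * (k%:R - m%:R) * e%:R) = 0 :> R.
      by have := @sin_pi_natB R (k * e) (m * e); rewrite !natrM -mulrBl mulrA.
    by rewrite cosB s0 mulr0 addr0 mulrC.
  rewrite mulrCA /theta_term; congr (_ * _); rewrite mulrC; congr (expR (_ * _) * _).
  by rewrite exprMn; ring.
have := has_integralZ (N%:R^-1) (has_integral_sum (index_enum 'I_N)
  (fun k : 'I_N => has_integral_sum (index_enum 'I_N) (fun m : 'I_N => H k m))).
apply: has_integral_eq => [t|].
  rewrite /fejer mulrCA; congr (_ * _); rewrite mulr_sumr; apply: eq_bigr => k _.
  by rewrite mulr_sumr.
rewrite /theta_mean mulrCA; congr (_ * _); rewrite mulr_sumr; apply: eq_bigr => k _.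
by rewrite mulr_sumr.
Qed.

End theta.

(** * Poisson summation for Gaussians *)

Section poisson.
Variables (R : realType) (delta : R) (e : nat).
Hypothesis delta_gt0 : 0 < delta.
Hypothesis e_le1 : (e <= 1)%N.
Notation mu := (@lebesgue_measure R).
Notation g := (gauss delta).
Notation x0 := (e%:R / 2 : R).

Let e01 : 0 <= x0 <= 2^-1.
Proof.
by move: e_le1; case: (e) => [|[|//]] _; apply/andP; split; lra.
Qed.

Lemma node_ge1 n : (1 + (n%:R + x0) ^+ 2)^-1 <= 2 * invsq R n.
Proof.
have /andP[a b] := e01; have := ler0n R n; move: (x0) a b => x a b.
rewrite /invsq -[n.+1%:R]natr1; move: (n%:R : R) => y y0.
have y1 : 0 < (y + 1) ^+ 2 by rewrite exprn_gt0//; lra.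
have D0 : 0 < 1 + (y + x) ^+ 2 by rewrite ltr_wpDr ?sqr_ge0.
rewrite -[leLHS]mul1r ler_pdivrMr// mulrAC ler_pdivlMr// mul1r.
have : 0 <= (y - 1) ^+ 2 by rewrite sqr_ge0.
nra.
Qed.

Lemma node_ge2 n : (1 + (n.+1%:R - x0) ^+ 2)^-1 <= 2 * invsq R n.
Proof.
have /andP[a b] := e01; have := ler0n R n; move: (x0) a b => x a b.
rewrite /invsq -[n.+1%:R]natr1; move: (n%:R : R) => y y0.
have y1 : 0 < (y + 1) ^+ 2 by rewrite exprn_gt0//; lra.
have D0 : 0 < 1 + (y + 1 - x) ^+ 2 by rewrite ltr_wpDr ?sqr_ge0.
rewrite -[leLHS]mul1r ler_pdivrMr// mulrAC ler_pdivlMr// mul1r.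
have : 0 <= (y - 1) ^+ 2 by rewrite sqr_ge0.
nra.
Qed.

(** The pairing n, -(n + 1) is the one by which [sumZ] splits the integers; it turns the two-sided
    sum into one series. *)
Definition lattice_gauss n : R := g (n%:R + x0) + g (- n.+1%:R + x0).

Lemma cvg_lattice_gauss : cvgn (series lattice_gauss).
Proof.
have [C C0 H] := gauss_decay delta_gt0.
have H1 y : g y <= C * (1 + y ^+ 2)^-1.
  apply: (le_trans (H y)); rewrite ler_pM2l// lef_pV2 ?posrE ?exprn_gt0 ?ltr_wpDr ?sqr_ge0//.
  by rewrite ler_eXnr// lerDl sqr_ge0.
apply: (@cvg_series_invsq_dom _ _ (C * 4)) => n.
rewrite ger0_norm; last by rewrite addr_ge0// ltW// gauss_gt0.
have -> : C * 4 * invsq R n = C * (2 * invsq R n) + C * (2 * invsq R n) by ring.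
rewrite lerD//; first by rewrite (le_trans (H1 _))// ler_wpM2l ?(ltW C0)// node_ge1.
rewrite -gaussN opprD opprK (le_trans (H1 _))// ler_wpM2l ?(ltW C0)// node_ge2//.
Qed.

Let lipschitz : exists2 C, 0 < C & forall y t, `|t| <= 2^-1 ->
  `|g (t + y) - g y| <= C * (1 + y ^+ 2)^-1 * `|t|.
Proof.
have [C C0 H] := gauss_derive_decay delta_gt0; exists (2 * C); first by rewrite mulr_gt0.
move=> y t t2.
have [c cI] := @MVT_between _ g _ y (t + y) (is_derive_gauss delta).
rewrite addrK => ->; rewrite normrM ler_wpM2r//.
rewrite !mulNr normrN (le_trans (H c))//.
have c0 : 0 < 1 + c ^+ 2 by rewrite ltr_wpDr ?sqr_ge0.
have y0 : 0 < 1 + y ^+ 2 by rewrite ltr_wpDr ?sqr_ge0.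
apply: (@le_trans _ _ (C / (1 + c ^+ 2))).
  by rewrite ler_pM2l// lef_pV2 ?posrE ?exprn_gt0// ler_eXnr// lerDl sqr_ge0.
rewrite ler_pdivrMr// mulrAC ler_pdivlMr// [2 * C]mulrC -mulrA ler_pM2l//.
(* The point [c] is within 1/2 of [y], which gives 1 + y^2 <= 2 (1 + c^2). *)
have yc : `|y - c| <= 2^-1.
  apply: le_trans t2.
  move: cI; case: (leP y (t + y)) => h /andP[c1 c2].
    by rewrite distrC !ger0_norm; lra.
  by rewrite ger0_norm ?ltr0_norm; lra.
move: yc; rewrite ler_norml => /andP[]; move: c0 y0 => _ _.
have : 0 <= (c - (y - c)) ^+ 2 by rewrite sqr_ge0.
nra.
Qed.

Let phi N t : R := fejer N.+1 t * unit_window t.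

Let has_b N y : {b | has_integral mu (fun t => g (t + y) * phi N t) b}.
Proof.
exists (Rintegral mu setT (fun t => g (t + y) * phi N t)).
apply: integrable_has_integral.
apply: (@integrable_dominated _ (measurableTypeR R) _ mu _ (phi N)).
- apply: measurable_funM; last exact: has_integral_measurable (has_integral_fejer R N).
  apply: measurable_continuous => x; apply: continuous_comp; last exact: continuous_gauss.
  by apply: cvgD; [exact: cvg_id|exact: cvg_cst].
- move=> x; have p0 : 0 <= phi N x.
    by rewrite mulr_ge0 ?fejer_ge0//; have /andP[] := unit_window_le x.
  rewrite normrM (ger0_norm p0) ger0_norm ?(ltW (gauss_gt0 _ _))//.
  by rewrite ler_piMl// gauss_le1.
- exact: (has_integral_fejer R N).1.
Qed.

Let b N y := sval (has_b N y).

Let has_window : has_integral mu (@unit_window R) 1.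
Proof.
have h : - 2^-1 < 2^-1 :> R by lra.
have := @has_integral_itv R (fun=> 1) (fun x => x) _ _ h (@continuous_fC R 1)
      (fun x => is_derive_id x 1).
by apply: has_integral_eq => [x|]; [rewrite mul1r|lra].
Qed.

(** Since |t| <= eps + t^2 / eps, the Lipschitz error |t| times the kernel is at most eps times the
    kernel plus eps^-1 / (N + 1): near and far points in a single inequality. The factor 1 / (1 +
    y^2) makes the errors summable over the nodes. *)
Let b_close : exists2 C, 0 < C & forall N y (eps : R), 0 < eps ->
  `|b N y - g y| <= C * (1 + y ^+ 2)^-1 * (eps + eps^-1 / N.+1%:R).
Proof.
have [C C0 H] := lipschitz; exists C => // N y eps eps0.
have D0 : 0 < 1 + y ^+ 2 by rewrite ltr_wpDr ?sqr_ge0.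
have I1 := has_integralB (svalP (has_b N y)) (has_integralZ (g y) (has_integral_fejer R N)).
have I2 := has_integralZ (C * (1 + y ^+ 2)^-1) (has_integralD
  (has_integralZ eps (has_integral_fejer R N)) (has_integralZ (eps^-1 / N.+1%:R) has_window)).
rewrite !mulr1 in I1 I2.
apply: has_integral_norm_le I1 I2 => t.
have /andP[w0 w1] := unit_window_le t.
rewrite -mulrBl normrM (ger0_norm (mulr_ge0 (fejer_ge0 _ _) w0)).
have [t2|t2] := leP `|t| 2^-1; last first.
  by rewrite (unit_window_supp t2) !mulr0 addr0 mulr0.
rewrite mulrA [eps * _]mulrA -mulrDl mulrA ler_wpM2r//.
apply: (@le_trans _ _ (C / (1 + y ^+ 2) * `|t| * fejer N.+1 t)).
  by rewrite ler_wpM2r ?fejer_ge0// H.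
rewrite -mulrA ler_wpM2l ?divr_ge0 ?(ltW C0) ?(ltW D0)//.
have := fejer_sqr_le N.+1 t2; have := fejer_ge0 N.+1 t.
rewrite -[t ^+ 2]real_normK ?num_real//.
move: (fejer _ _) (N.+1%:R^-1) `|t| (normr_ge0 t) => F K s s0 F0 FK.
rewrite -(ler_pM2l eps0) mulrDr !mulrA divff ?gt_eqF// mul1r.
apply: le_trans (lerD (lexx _) FK); rewrite -mulrDl ler_wpM2r//.
have : 0 <= (eps - s) ^+ 2 by rewrite sqr_ge0.
nra.
Qed.

Let A N := (Num.sqrt delta)^-1 * theta_mean delta^-1 e N.+1.

Let has_A N : has_integral mu (fun t => g t * fejer N.+1 (t - x0)) (A N).
Proof.
have := gauss_fejer 1 e N.+1 delta_gt0; apply: has_integral_eq => [t|].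
  by rewrite mul1r.
by rewrite expr1n mul1r.
Qed.

(** The union of the unit windows around -M, ..., M - 1: asymmetric because the partial sums cover n
    and -(n + 1) for n < M. *)
Let big_window M (t : R) : R := ((- M%:R - 2^-1 <= t) && (t < M%:R - 2^-1))%:R.

Let big_windowS M t : big_window M.+1 t =
  big_window M t + (unit_window (t - M%:R) + unit_window (t + M.+1%:R)).
Proof.
rewrite /big_window !unit_windowE -natr1; have := ler0n R M.
move: (M%:R : R) => m m0.
have -> : (- 2^-1 <= t - m) = (m - 2^-1 <= t) by apply/idP/idP; lra.
have -> : (t - m < 2^-1) = (t < m + 1 - 2^-1) by apply/idP/idP; lra.
have -> : (- 2^-1 <= t + (m + 1)) = (- (m + 1) - 2^-1 <= t) by apply/idP/idP; lra.
have -> : (t + (m + 1) < 2^-1) = (t < - m - 2^-1) by apply/idP/idP; lra.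
case: (leP (- (m + 1) - 2^-1) t) => h1; case: (leP (- m - 2^-1) t) => h2;
case: (leP (m - 2^-1) t) => h3; case: (ltP t (m + 1 - 2^-1)) => h4 /=;
  rewrite ?addr0 ?add0r//; exfalso; lra.
Qed.

(** By periodicity of the kernel, the integral over each unit interval is moved to the interval
    around 0, where it is a value of [b]. *)
Let has_truncated N M : has_integral mu
  (fun t => g t * fejer N.+1 (t - x0) * big_window M (t - x0))
  (\sum_(n < M) (b N (n%:R + x0) + b N (- n.+1%:R + x0))).
Proof.
elim: M => [|M IH].
  rewrite big_ord0; apply: has_integral_eq (has_integral0 _) => // t.
  rewrite /big_window (_ : _ && _ = false) ?mulr0//.
  by apply/negbTE/negP => /andP[]; lra.
rewrite big_ord_recr/=; apply: has_integral_eq (has_integralD IH (has_integralD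
   (has_integral_shift (- (M%:R + x0)) (svalP (has_b N (M%:R + x0))))
   (has_integral_shift (- (- M.+1%:R + x0)) (svalP (has_b N (- M.+1%:R + x0))))))
  => // t.
rewrite big_windowS mulrDr; congr (_ + _).
rewrite !subrK mulrDr /phi; congr (_ + _).
  rewrite opprD addrA addrAC fejerBn -mulrA; congr (_ * (_ * unit_window _)).
by rewrite opprD opprK addrCA [M.+1%:R + _]addrC fejerDn -mulrA.
Qed.

Let cvg_truncated N :
  \sum_(n < M) (b N (n%:R + x0) + b N (- n.+1%:R + x0)) @[M --> \oo] --> A N.
Proof.
have [If IA] := has_A N.
have [] := @has_integral_dct _ _ _ mu set0
  (fun M t => g t * fejer N.+1 (t - x0) * big_window M (t - x0)) _
  (fun t => g t * fejer N.+1 (t - x0)) (fun t => `|g t * fejer N.+1 (t - x0)|)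
  measurable0 (measure0 _) (has_truncated N).
- exact: has_integral_measurable (has_A N).
- move=> t _; apply: cvg_near_cst; near=> M.
  rewrite /big_window (_ : _ && _ = true) ?mulr1//.
  have : `|t - x0| + 1 <= M%:R by near: M; exact: nbhs_infty_ger.
  have := normr_ge0 (t - x0); have := ler_norm (t - x0); have := ler_norm (- (t - x0)).
  by rewrite normrN; move: (M%:R : R) (t - x0) => m s; lra.
- move=> M t _; rewrite normrM ler_piMr// /big_window.
  by case: (_ && _); rewrite ?normr1 ?normr0.
- exact: integrable_norm.
by move=> _; rewrite IA.
Unshelve. all: by end_near. Qed.

Let A_close : exists2 K, 0 < K & forall N (eps : R), 0 < eps ->
  `|A N - limn (series lattice_gauss)| <= K * (eps + eps^-1 / N.+1%:R).
Proof.
have [C C0 H] := b_close; exists (C * 8); first by rewrite mulr_gt0.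
move=> N eps eps0; have E0 : 0 <= eps + eps^-1 / N.+1%:R.
  by rewrite addr_ge0 ?divr_ge0 ?invr_ge0// ltW.
have L := @cvg_dist_le R _ (series lattice_gauss) (A N) (limn (series lattice_gauss))
  (C * 8 * (eps + eps^-1 / N.+1%:R)) (@cvg_truncated N) cvg_lattice_gauss.
apply: L => M.
 rewrite /series/= big_mkord -sumrB.
apply: (le_trans (ler_norm_sum _ _ _)).
apply: (@le_trans _ _ (\sum_(n < M) C * 4 * (eps + eps^-1 / N.+1%:R) * invsq R n)).
  apply: ler_sum => n _; rewrite /lattice_gauss opprD addrACA.
  apply: (le_trans (ler_normD _ _)).
  have -> : C * 4 * (eps + eps^-1 / N.+1%:R) * invsq R n =
    C * (2 * invsq R n) * (eps + eps^-1 / N.+1%:R) + C * (2 * invsq R n) * (eps + eps^-1 / N.+1%:R) by ring.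
  apply: lerD.
    apply: (le_trans (H _ _ _ eps0)); rewrite ler_wpM2r// ler_pM2l//; exact: node_ge1.
  apply: (le_trans (H _ _ _ eps0)); rewrite ler_wpM2r// ler_pM2l//.
  have -> : (- n.+1%:R + x0) ^+ 2 = (n.+1%:R - x0) ^+ 2 by ring.
  exact: node_ge2.
rewrite -mulr_sumr.
have -> : C * 8 * (eps + eps^-1 / N.+1%:R) = C * 4 * (eps + eps^-1 / N.+1%:R) * 2 by ring.
by rewrite ler_wpM2l ?sum_invsq_le// !mulr_ge0// ltW.
Qed.

(** The integral of g against the periodic kernel with peaks at Z + e/2 is evaluated twice: term by
    term it is a Cesàro mean of [theta], and interval by interval it is close to the sum of g over
    the nodes. *)
Theorem poisson_gauss : limn (series lattice_gauss) = (Num.sqrt delta)^-1 * theta delta^-1 e.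
Proof.
have A1 : A n @[n --> \oo] --> (Num.sqrt delta)^-1 * theta delta^-1 e.
  by apply: cvgM; [exact: cvg_cst|apply: cvg_theta_mean; rewrite invr_gt0].
suff A2 : A n @[n --> \oo] --> limn (series lattice_gauss).
  by apply: cvg_unique A2 A1; exact: Rhausdorff.
have [K K0 H] := A_close.
apply/cvgrPdistC_le => eta eta0.
(* This makes the first error term eta / 2 for every N; a large N then handles the second. *)
pose eps := eta / (2 * K); have eps0 : 0 < eps by rewrite divr_gt0// mulr_gt0.
near=> N; apply: (le_trans (H N eps eps0)).
have : K * eps^-1 / N.+1%:R <= eta / 2.
  near: N; have /cvgr0Pnorm_le := cvg_inv_nat (K * eps^-1).
  move=> /(_ (eta / 2)); rewrite divr_gt0// => /(_ isT); apply: filterS => n.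
  exact: le_trans (ler_norm _).
have : K * eps = eta / 2 by rewrite /eps; field; rewrite gt_eqF.
by move=> h1 h2; rewrite mulrDr h1 [leRHS]splitr lerD2l mulrA.
Unshelve. all: by end_near. Qed.

End poisson.

(** * Integrals of the one-variable interpolants *)

Section sine_pairs.
Variable R : realType.
Notation mu := (@lebesgue_measure R).
Implicit Types u v z nu : R.

(** Peetre's inequality; the difference of the two sides, cleared of denominators, is a sum of
    nonnegative squares. It trades a translate for a factor that grows with the node. *)
Lemma shift_oneDsqr z y : (1 + (z - y) ^+ 2)^-1 <= 2 * (1 + y ^+ 2) / (1 + z ^+ 2).
Proof.
have D0 (x : R) : 0 < 1 + x ^+ 2 by rewrite ltr_wpDr ?sqr_ge0.
rewrite ler_pdivlMr// ler_pdivrMl//.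
rewrite -subr_ge0.
have -> : (1 + (z - y) ^+ 2) * (2 * (1 + y ^+ 2)) - (1 + z ^+ 2) =
  1 + (z - y - y) ^+ 2 + 2 * ((z - y) ^+ 2 * y ^+ 2) by ring.
by rewrite !addr_ge0 ?sqr_ge0// mulr_ge0// mulr_ge0 ?sqr_ge0.
Qed.

Lemma sincsq_shift_le z y : sincsq (z - y) <= 4 * (1 + y ^+ 2) / (1 + z ^+ 2).
Proof.
have /andP[_ h] := sincsq_le (z - y); apply: (le_trans h).
have -> : 4 * (1 + y ^+ 2) / (1 + z ^+ 2) = 2 * (2 * (1 + y ^+ 2) / (1 + z ^+ 2)) by ring.
by rewrite ler_pM2l// shift_oneDsqr.
Qed.

(** Of order 1 / u at infinity, hence integrable only in pairs of translates or after damping. *)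
Definition sinv u : R := sin (pi * u) ^+ 2 / u.

(** A damping factor that tends to 1 and makes [sinv] integrable. For fixed n all translates of the
    damped function have the same integral, so a damped pair integrates to 0. *)
Let cutoff (n : nat) u : R := n.+1%:R ^+ 2 / (n.+1%:R ^+ 2 + u ^+ 2).

Let cutoff_D0 n u : 0 < n.+1%:R ^+ 2 + u ^+ 2.
Proof. by rewrite ltr_wpDr ?sqr_ge0// exprn_gt0// ltr0n. Qed.

Let sinv_le u : `|sinv u| <= pi.
Proof.
have [->|u0] := eqVneq u 0; first by rewrite /sinv invr0 mulr0 normr0 pi_ge0.
rewrite /sinv normrM normfV ler_pdivrMr ?normr_gt0// expr2 normrM.
rewrite -[leRHS]mul1r ler_pM ?sin_max//.
by rewrite (le_trans (sin_norm_le _))// normrM ger0_norm ?pi_ge0.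
Qed.

Let measurable_sinv : measurable_fun [set: measurableTypeR R] (sinv : measurableTypeR R -> R).
Proof.
apply: measurable_funM; last exact: measurable_invr.
apply: measurable_funX; apply: measurable_continuous.
by have := @continuous_sin_affine R pi 0; under eq_fun do rewrite addr0.
Qed.

Let integrable_cutoff n : mu.-integrable [set: R] (EFin \o (fun u => sinv u * cutoff n u)).
Proof.
apply: (@integrable_dominated _ (measurableTypeR R) _ mu _
   (fun u => pi * n.+1%:R ^+ 2 * (1 + u ^+ 2)^-1)).
- apply: measurable_funM => //; apply: measurable_continuous.
  move=> x; apply: cvgM; first exact: cvg_cst.
  apply: cvgV; first by rewrite gt_eqF.
  by apply: cvgD; [exact: cvg_cst|exact: exprn_continuous].
- move=> u; rewrite normrM -mulrA ler_pM// ger0_norm; last first.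
    by rewrite divr_ge0 ?sqr_ge0// ltW.
  rewrite ler_pM2l ?exprn_gt0// lef_pV2 ?posrE//; last by rewrite ltr_wpDr ?sqr_ge0.
  by rewrite lerD2r -[leLHS](expr1n _ 2) lerXn2r ?nnegrE// ler1n.
- exact: (has_integralZ _ (integrable_has_integral (integrable_oneDsqrV R))).1.
Qed.

Let cvg_cutoff u : cutoff n u @[n --> \oo] --> (1 : R).
Proof.
have H : u ^+ 2 / n.+1%:R @[n --> \oo] --> (0 : R) by exact: cvg_inv_nat.
apply/cvgrPdistC_le => e e0; move/cvgrPdistC_le : H => /(_ _ e0).
apply: filterS => n; rewrite subr0; apply: le_trans.
have n0 : 0 < n.+1%:R :> R by rewrite ltr0n.
have n1 : 1 <= n.+1%:R :> R by rewrite ler1n.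
have D0 := cutoff_D0 n u.
have -> : cutoff n u - 1 = - (u ^+ 2 / (n.+1%:R ^+ 2 + u ^+ 2)).
  rewrite /cutoff; move: (n.+1%:R : R) D0 => m D0.
  by field; rewrite gt_eqF.
rewrite normrN !normrM ler_wpM2l// !normfV lef_pV2 ?posrE ?normr_gt0 ?gt_eqF//.
rewrite !gtr0_norm// (@le_trans _ _ (n.+1%:R ^+ 2))//; first by rewrite ler_eXnr.
by rewrite lerDl sqr_ge0.
Qed.

(** Uniformity in the damping parameter N makes domination possible. The difference is rho (v - u) /
    (u v), and 3 / 2 comes from u v <= (u^2 + v^2) / 2 in the numerator of rho. *)
Lemma cutoff_difference_le (N u v : R) : 0 < N -> u != 0 -> v != 0 ->
  `|N / (u * (N + u ^+ 2)) - N / (v * (N + v ^+ 2))| <= 3 / 2 * (`|v - u| / (`|u| * `|v|)).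
Proof.
move=> N0 u0 v0.
have Du : 0 < N + u ^+ 2 by rewrite ltr_wpDr ?sqr_ge0.
have Dv : 0 < N + v ^+ 2 by rewrite ltr_wpDr ?sqr_ge0.
pose rho := N * (N + u ^+ 2 + u * v + v ^+ 2) / ((N + u ^+ 2) * (N + v ^+ 2)).
have -> : N / (u * (N + u ^+ 2)) - N / (v * (N + v ^+ 2)) = rho * ((v - u) / (u * v)).
  by rewrite /rho; field; rewrite u0 v0 !gt_eqF.
have h1 : 0 <= (u + v) ^+ 2 by rewrite sqr_ge0.
have h2 : 0 <= (u - v) ^+ 2 by rewrite sqr_ge0.
have h3 : 0 <= u ^+ 2 * v ^+ 2 by rewrite mulr_ge0 ?sqr_ge0.
have h4 := sqr_ge0 u; have h5 := sqr_ge0 v.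
have r0 : 0 <= rho.
  apply: divr_ge0; last by rewrite mulr_ge0// ltW.
  by apply: mulr_ge0; [exact: ltW|nra].
have r1 : rho <= 3 / 2.
  rewrite ler_pdivrMr ?mulr_gt0//.
  have : N * (u * v) <= N * ((u ^+ 2 + v ^+ 2) / 2) by rewrite ler_pM2l//; nra.
  have : 0 <= N * N by rewrite mulr_ge0// ltW.
  nra.
rewrite normrM (ger0_norm r0) normrM normfV normrM.
by rewrite ler_wpM2r// divr_ge0// mulr_ge0.
Qed.

Section pair.
Variable nu : R.
Hypothesis nu0 : 0 <= nu.
Hypothesis nuE : forall z, sin (pi * (z - nu)) ^+ 2 = sin (pi * (z + nu)) ^+ 2.

(** 12 = (3 / 2) * 2 * 4: the bound on rho, the distance 2 nu of the two nodes, and the constant of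
    [sincsq_shift_le]. *)
Let K : R := 12 * pi ^+ 2 * nu * (1 + nu ^+ 2).

Let pair_cutoff_le n z :
  `|sinv (z - nu) * cutoff n (z - nu) - sinv (z + nu) * cutoff n (z + nu)| <=
   K * (1 + z ^+ 2)^-1.
Proof.
have D0 : 0 < 1 + z ^+ 2 by rewrite ltr_wpDr ?sqr_ge0.
have K0 : 0 <= K * (1 + z ^+ 2)^-1.
  rewrite divr_ge0 ?(ltW D0)// mulr_ge0 ?addr_ge0 ?sqr_ge0//.
  by rewrite mulr_ge0// mulr_ge0// sqr_ge0.
(* At a node both sines vanish by [nuE], so both values of [sinv] are 0. *)
have [z1|z1] := eqVneq (z - nu) 0.
  have w0 : sin (pi * (z + nu)) ^+ 2 = 0 by rewrite -nuE z1 mulr0 sin0 expr0n.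
  by rewrite /sinv w0 z1 mulr0 sin0 expr0n/= !mul0r subrr normr0.
have [z2|z2] := eqVneq (z + nu) 0.
  have w0 : sin (pi * (z - nu)) ^+ 2 = 0 by rewrite nuE z2 mulr0 sin0 expr0n.
  by rewrite /sinv w0 z2 mulr0 sin0 expr0n/= !mul0r subrr normr0.
have B1 := sincsq_shift_le z nu.
have B2 : sincsq (z + nu) <= 4 * (1 + nu ^+ 2) / (1 + z ^+ 2).
  by have := sincsq_shift_le z (- nu); rewrite opprK sqrrN.
have N0 : 0 < n.+1%:R ^+ 2 :> R by rewrite exprn_gt0// ltr0n.
have := cutoff_difference_le N0 z1 z2.
have -> : z + nu - (z - nu) = 2 * nu by ring.
rewrite (ger0_norm (mulr_ge0 _ nu0))//.
move: z1 z2 B1 B2 (nuE z); rewrite /sincsq.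
set u := z - nu; set v := z + nu; set s := sin (pi * u); set t := sin (pi * v).
move=> u0 v0 B1 B2 st H.
have -> : sinv u * cutoff n u - sinv v * cutoff n v =
  s ^+ 2 * (n.+1%:R ^+ 2 / (u * (n.+1%:R ^+ 2 + u ^+ 2)) - n.+1%:R ^+ 2 / (v * (n.+1%:R ^+ 2 + v ^+ 2))).
  rewrite mulrBr {2}st /sinv /cutoff -/s -/t !invfM; ring.
(* The common square is shared between the two nodes, so that each quotient is controlled by its own
   sinc bound. *)
have ss : s ^+ 2 = `|s| * `|t|.
  have -> : `|t| = `|s|.
    by apply/eqP; rewrite -(@eqrXn2 _ 2)// !real_normK ?num_real// st.
  by rewrite -expr2 real_normK ?num_real.
rewrite normrM (ger0_norm (sqr_ge0 _)) ss.
apply: (le_trans (ler_wpM2l (mulr_ge0 (normr_ge0 _) (normr_ge0 _)) H)).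
have p0 := pi_gt0 R.
have aux (a b c : R) : a != 0 -> a * (b / (a * c)) = b / c.
  by move=> a0; rewrite invfM mulrCA mulVKf.
have E1 : pi ^+ 2 * (s / (pi * u)) ^+ 2 = (`|s| / `|u|) ^+ 2.
  rewrite -normf_div real_normK ?num_real// !expr_div_n exprMn.
  by rewrite aux// expf_neq0// gt_eqF.
have E2 : pi ^+ 2 * (t / (pi * v)) ^+ 2 = (`|t| / `|v|) ^+ 2.
  rewrite -normf_div real_normK ?num_real// !expr_div_n exprMn.
  by rewrite aux// expf_neq0// gt_eqF.
have C1 : (`|s| / `|u|) ^+ 2 <= pi ^+ 2 * (4 * (1 + nu ^+ 2) / (1 + z ^+ 2)).
  by rewrite -E1 ler_wpM2l// sqr_ge0.
have C2 : (`|t| / `|v|) ^+ 2 <= pi ^+ 2 * (4 * (1 + nu ^+ 2) / (1 + z ^+ 2)).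
  by rewrite -E2 ler_wpM2l// sqr_ge0.
have -> : `|s| * `|t| * (3 / 2 * (2 * nu / (`|u| * `|v|))) =
  3 * nu * ((`|s| / `|u|) * (`|t| / `|v|)) by rewrite invfM; field; rewrite !normr_eq0 u0 v0.
have -> : K * (1 + z ^+ 2)^-1 = 3 * nu * (pi ^+ 2 * (4 * (1 + nu ^+ 2) / (1 + z ^+ 2))).
  by rewrite /K; ring.
rewrite ler_wpM2l ?mulr_ge0//.
move: C1 C2; move: (`|s| / `|u|) (`|t| / `|v|) => a b.
have : 0 <= (a - b) ^+ 2 by rewrite sqr_ge0.
move: (pi ^+ 2 * _) => c; nra.
Qed.

Let pair_cvg z : sinv (z - nu) * cutoff n (z - nu) - sinv (z + nu) * cutoff n (z + nu)
   @[n --> \oo] --> sinv (z - nu) - sinv (z + nu).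
Proof.
rewrite -[X in _ --> X - _]mulr1 -[X in _ --> _ - X]mulr1.
by apply: cvgB; apply: cvgM; [exact: cvg_cst|exact: cvg_cutoff|exact: cvg_cst|exact: cvg_cutoff].
Qed.

Lemma sinv_pair_le z : `|sinv (z - nu) - sinv (z + nu)| <= K * (1 + z ^+ 2)^-1.
Proof.
rewrite -[X in `|X|]subr0; apply: (@cvg_dist_le R _ (fun=> 0) _ 0 _ (@pair_cvg z)) => [|n].
  exact: cvg_cst.
by rewrite subr0 pair_cutoff_le.
Qed.

Lemma has_integral_sinv_pair : has_integral mu (fun z => sinv (z - nu) - sinv (z + nu)) 0.
Proof.
have I n := integrable_has_integral (integrable_cutoff n).
have [] := @has_integral_dct _ _ _ mu set0
  (fun n z => sinv (z - nu) * cutoff n (z - nu) - sinv (z + nu) * cutoff n (z + nu))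
  (fun=> 0) (fun z => sinv (z - nu) - sinv (z + nu)) (fun z => K * (1 + z ^+ 2)^-1)
  measurable0 (measure0 _).
- move=> n; have := has_integralB (has_integral_shift (- nu) (I n)) (has_integral_shift nu (I n)).
  by rewrite subrr.
- apply: measurable_funB; apply: (measurableT_comp measurable_sinv); apply: measurable_continuous.
  + by apply: continuous_fB; [exact: continuous_fid|exact: continuous_fC].
  + by apply: continuous_fD; [exact: continuous_fid|exact: continuous_fC].
- by move=> z _; exact: pair_cvg.
- by move=> n z _; exact: pair_cutoff_le.
- exact: (has_integralZ _ (integrable_has_integral (integrable_oneDsqrV R))).1.
move=> [If _] L; split => //.
by apply: cvg_unique L _; [exact: Rhausdorff|exact: cvg_cst].
Qed.

End pair.
End sine_pairs.

Section sine_zeros.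
Variable R : realType.

Lemma sin_pi_int (k : int) : sin (pi * k%:~R) = 0 :> R.
Proof.
case: k => n; first exact: sin_pi_nat.
by rewrite NegzE mulrNz mulrN sinN sin_pi_nat oppr0.
Qed.

Lemma sin_pi_eq0 (t : R) : sin (pi * t) = 0 -> t = (Num.floor t)%:~R.
Proof.
move=> s0; apply/eqP; rewrite -subr_eq0; apply/negPn/negP => t0.
have /andP[f1 f2] := floor_itv t.
have p0 := pi_gt0 R.
have : sin (pi * (t - (Num.floor t)%:~R)) = 0.
  by rewrite mulrBr sinB s0 sin_pi_int mul0r mulr0 subr0.
apply/eqP; rewrite gt_eqF// sin_gt0_pi//.
rewrite mulr_gt0//=; last by rewrite lt_def t0 subr_ge0.
by rewrite -[ltRHS]mulr1 ltr_pM2l// ltrBlDl -intrD1.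
Qed.

End sine_zeros.

(** * Hermite interpolation of the Gaussian at the nodes Z + e/2 *)

Section interpolation.
Variables (R : realType) (delta : R) (e : nat).
Hypothesis delta_gt0 : 0 < delta.
Hypothesis e_le1 : (e <= 1)%N.
Notation mu := (@lebesgue_measure R).
Notation g := (gauss delta).
Notation x0 := (e%:R / 2 : R).
Notation dg := (derive1 (gauss delta)).

(** The common form of [m_formula] (e = 0) and [l_formula] (e = 1), as cos(pi z)^2 = sin(pi (z -
    1/2))^2. *)
Definition hermite_formula (z : R) : R :=
  (sin (pi * (z - x0)) / pi) ^+ 2 *
  (sumZ (fun k : int => g (k%:~R + x0) / (z - (k%:~R + x0)) ^+ 2) +
   sumZ (fun k : int => dg (k%:~R + x0) / (z - (k%:~R + x0)))).

Let w (z : R) : R := sin (pi * (z - x0)).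
Let y n : R := n%:R + x0.
Let nu n : R := n.+1%:R - x0.

Let dgE t : dg t = - (2 * delta * pi) * t * g t.
Proof. by rewrite derive1E; have := is_derive_gauss delta t => H; rewrite derive_val. Qed.

Let dgN t : dg (- t) = - dg t.
Proof. by rewrite !dgE gaussN; ring. Qed.

Let e01 : 0 <= x0 <= 2^-1.
Proof. by move: e_le1; case: (e) => [|[|//]] _; apply/andP; split; lra. Qed.

Let nu_ge0 n : 0 <= nu n.
Proof. by rewrite /nu -natr1; have /andP[_ h] := e01; have := ler0n R n; lra. Qed.

Let sin_natB (z : R) n : sin (pi * (z - n%:R)) ^+ 2 = sin (pi * z) ^+ 2.
Proof. by rewrite mulrBr sinB sin_pi_nat mulr0 subr0 cos_pi_nat exprMn sqrr_sign mulr1. Qed.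

Let sin_natD (z : R) n : sin (pi * (z + n%:R)) ^+ 2 = sin (pi * z) ^+ 2.
Proof. by rewrite -(sin_natB _ n) addrK. Qed.

Let wy z n : sin (pi * (z - y n)) ^+ 2 = w z ^+ 2.
Proof. by rewrite /y opprD addrA addrAC sin_natB. Qed.

Let wnu z n : sin (pi * (z + nu n)) ^+ 2 = w z ^+ 2.
Proof. by rewrite /nu addrA addrAC sin_natD. Qed.

Let nuE n z : sin (pi * (z - nu n)) ^+ 2 = sin (pi * (z + nu n)) ^+ 2.
Proof.
rewrite wnu /nu opprB addrA sin_natB /w.
have -> : z + x0 = z - x0 + e%:R by field.
by rewrite sin_natD.
Qed.

Let Negz_node n : (Negz n)%:~R + x0 = - nu n.
Proof. by rewrite NegzE mulrNz /nu opprB addrC. Qed.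

Let decay : exists2 C, 0 < C & forall t,
  [/\ g t * (1 + t ^+ 2) <= C * (1 + t ^+ 2)^-1, `|dg t| <= C * (1 + t ^+ 2)^-1 &
      `|dg t| * `|t| * (1 + t ^+ 2) <= C * (1 + t ^+ 2)^-1].
Proof.
have [C1 C10 H1] := gauss_decay delta_gt0.
have [C2 C20 H2] := gauss_derive_decay delta_gt0.
exists (C1 + C2) => [|t]; first by rewrite addr_gt0.
have X1 : 1 <= 1 + t ^+ 2 by rewrite lerDl sqr_ge0.
have tX : `|t| <= 1 + t ^+ 2.
  rewrite -real_normK ?num_real//; have := normr_ge0 t.
  have : 0 <= (`|t| - 1) ^+ 2 by rewrite sqr_ge0.
  nra.
have dgle : `|dg t| <= C2 / (1 + t ^+ 2) ^+ 3 by rewrite dgE !mulNr normrN H2.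
move: (H1 t) X1 tX dgle; move: (1 + t ^+ 2) => X gle X1 tX dgle.
have X0 : 0 < X by rewrite (lt_le_trans ltr01).
have r0 : 0 < X^-1 by rewrite invr_gt0.
have r1 : X^-1 <= 1 by rewrite invf_le1.
have r3 : X^-1 ^+ 3 <= X^-1 by rewrite exprS ler_piMr ?(ltW r0)// exprn_ile1 ?(ltW r0).
have Xn0 : X != 0 by rewrite gt_eqF.
split.
- apply: (le_trans (ler_wpM2r (ltW X0) gle)).
  have -> : C1 / X ^+ 4 * X = C1 * X^-1 ^+ 3 by field.
  by apply: ler_pM => //; [exact: ltW|rewrite exprn_ge0 ?ltW|rewrite lerDl ltW].
- apply: (le_trans dgle); rewrite -exprVn.
  by apply: ler_pM => //; [exact: ltW|rewrite exprn_ge0 ?ltW|rewrite lerDr ltW].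
- have h : `|dg t| * `|t| <= C2 / X ^+ 3 * X by apply: ler_pM.
  apply: (le_trans (ler_wpM2r (ltW X0) h)).
  have -> : C2 / X ^+ 3 * X * X = C2 / X by field.
  by rewrite ler_wpM2r ?ltW// ltrDr.
Qed.

(** The derivative of g is odd, so the nodes nu n and -nu n combine into an integrable pair. For e =
    0 the node 0 drops out of the second sum, where g' vanishes, and [nu] runs one step ahead of
    [y]. *)
Let part M (z : R) : R :=
  \sum_(n < M) (g (y n) * sincsq (z - y n) + g (- nu n) * sincsq (z + nu n)) +
  \sum_(n < M) dg (nu n) / pi ^+ 2 * (sinv (z - nu n) - sinv (z + nu n)).

Let has_part M : has_integral mu (part M) (\sum_(n < M) lattice_gauss delta e n).
Proof.
rewrite -[X in has_integral _ _ X]addr0; apply: has_integralD.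
  apply: has_integral_sum => n; rewrite /lattice_gauss.
  apply: has_integralD.
    have := has_integralZ (g (y n)) (has_integral_shift (- y n) (has_integral_sincsq R)).
    by rewrite mulr1.
  have := has_integralZ (g (- nu n)) (has_integral_shift (nu n) (has_integral_sincsq R)).
  by rewrite mulr1 -Negz_node NegzE mulrNz.
have := has_integral_sum (index_enum 'I_M) (fun n : 'I_M =>
  has_integralZ (dg (nu n) / pi ^+ 2) (has_integral_sinv_pair (nu_ge0 n) (nuE n))).
by apply: has_integral_eq => // ; rewrite big1// => n _; rewrite mulr0.
Qed.

Let part_le : exists C, forall M z, `|part M z| <= C * (1 + z ^+ 2)^-1.
Proof.
have [C C0 H] := decay.
(* 40 = 8 + 8 + 24, from the two squared terms and the derivative pair; the factor 2 bounds the sum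
   of [invsq]. *)
exists (2 * (40 * C)) => M z.
have D0 : 0 < 1 + z ^+ 2 by rewrite ltr_wpDr ?sqr_ge0.
have -> : part M z = \sum_(n < M) (g (y n) * sincsq (z - y n) + g (- nu n) * sincsq (z + nu n) +
  dg (nu n) / pi ^+ 2 * (sinv (z - nu n) - sinv (z + nu n))) by rewrite /part -big_split.
apply: (le_trans (ler_norm_sum _ _ _)).
apply: (@le_trans _ _ (\sum_(n < M) 40 * C * (1 + z ^+ 2)^-1 * invsq R n)); last first.
  have -> : 2 * (40 * C) / (1 + z ^+ 2) = 40 * C * (1 + z ^+ 2)^-1 * 2 by ring.
  rewrite -mulr_sumr ler_wpM2l ?sum_invsq_le//.
  by rewrite mulr_ge0 ?invr_ge0 ?(ltW D0)// mulr_ge0// ltW.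
apply: ler_sum => n _.
have -> : 40 * C * (1 + z ^+ 2)^-1 * invsq R n =
  8 * C * (1 + z ^+ 2)^-1 * invsq R n + 8 * C * (1 + z ^+ 2)^-1 * invsq R n
  + 24 * C * (1 + z ^+ 2)^-1 * invsq R n by ring.
have Dp (p : R) : 0 < 1 + p ^+ 2 by rewrite ltr_wpDr ?sqr_ge0.
have sum_term p : (1 + p ^+ 2)^-1 <= 2 * invsq R n ->
    `|g p * sincsq (z - p)| <= 8 * C * (1 + z ^+ 2)^-1 * invsq R n.
  move=> hp; have [hg _ _] := H p.
  rewrite ger0_norm; last by rewrite mulr_ge0 ?sqr_ge0// ltW// gauss_gt0.
  apply: (le_trans (ler_wpM2l (ltW (gauss_gt0 _ _)) (sincsq_shift_le z p))).
  have -> : g p * (4 * (1 + p ^+ 2) / (1 + z ^+ 2)) = g p * (1 + p ^+ 2) * (4 / (1 + z ^+ 2)) by ring.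
  have -> : 8 * C * (1 + z ^+ 2)^-1 * invsq R n = C * (2 * invsq R n) * (4 / (1 + z ^+ 2)) by ring.
  rewrite ler_wpM2r ?divr_ge0 ?(ltW D0)//; apply: (le_trans hg).
  by rewrite ler_pM2l.
apply: (le_trans (ler_normD _ _)); apply: lerD.
  apply: (le_trans (ler_normD _ _)); apply: lerD.
    exact/sum_term/node_ge1.
  by rewrite -[X in sincsq (z + X)]opprK; apply: sum_term; rewrite sqrrN; exact: node_ge2.
have [_ _ hd] := H (nu n).
rewrite normrM normrM normfV (ger0_norm (sqr_ge0 pi)).
apply: (le_trans (ler_wpM2l _ (sinv_pair_le (nu_ge0 n) (nuE n) z))).
  by rewrite divr_ge0 ?sqr_ge0.
rewrite (ger0_norm (nu_ge0 n)) in hd.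
have -> : `|dg (nu n)| / pi ^+ 2 * (12 * pi ^+ 2 * nu n * (1 + nu n ^+ 2) / (1 + z ^+ 2)) =
  `|dg (nu n)| * nu n * (1 + nu n ^+ 2) * (12 / (1 + z ^+ 2)).
  have : (pi : R) != 0 by rewrite gt_eqF ?pi_gt0.
  move: (pi : R) => p p0; have := gt_eqF (Dp z); move: (1 + z ^+ 2) => X /negbT X0.
  by field; rewrite p0 X0.
have -> : 24 * C * (1 + z ^+ 2)^-1 * invsq R n = C * (2 * invsq R n) * (12 / (1 + z ^+ 2)) by ring.
rewrite ler_wpM2r ?divr_ge0 ?(ltW D0)//; apply: (le_trans hd).
by rewrite ler_pM2l// node_ge2.
Qed.

Let cvg_part z : w z != 0 -> part M z @[M --> \oo] --> hermite_formula z.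
Proof.
move=> w0; have [C C0 H] := decay; have p0 := pi_gt0 R.
set W := (w z / pi) ^+ 2.
have W0 : 0 < W by rewrite exprn_even_gt0//= mulf_neq0// invr_neq0// gt_eqF.
have away p : sin (pi * (z - p)) ^+ 2 = w z ^+ 2 ->
    [/\ z - p != 0, sincsq (z - p) = W / (z - p) ^+ 2 & sinv (z - p) / pi ^+ 2 = W / (z - p)].
  move=> hp; split.
  - apply: contra_neq w0 => u0; apply/eqP; rewrite -sqrf_eq0 -hp u0 mulr0 sin0.
    by rewrite expr0n.
  - by rewrite /sincsq expr_div_n exprMn invfM mulrA /W expr_div_n hp.
  - by rewrite /sinv /W expr_div_n hp mulrAC.
have dom p n : (1 + p ^+ 2)^-1 <= 2 * invsq R n -> sin (pi * (z - p)) ^+ 2 = w z ^+ 2 ->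
    `|g p / (z - p) ^+ 2| <= 4 * C / W * invsq R n /\
    `|dg p / (z - p)| <= C * (1 + 2 / W) * 2 * invsq R n.
  move=> hp /away[u0 Su _]; have [hg hd _] := H p.
  (* The bound sinc² <= 2 reads W / (z - p)^2 <= 2 here: the distance from z to the nodes is
     controlled by W, uniformly in p. *)
  have u2 : ((z - p) ^+ 2)^-1 <= 2 / W.
    rewrite ler_pdivlMr// mulrC -Su; have /andP[_ /le_trans] := sincsq_le (z - p); apply.
    by rewrite ler_piMr// invf_le1 ?lerDl ?sqr_ge0// ltr_wpDr ?sqr_ge0.
  have g1 : g p <= C * (2 * invsq R n).
    apply: (@le_trans _ _ (g p * (1 + p ^+ 2))).
      by rewrite ler_peMr ?lerDl ?sqr_ge0// ltW// gauss_gt0.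
    by apply: (le_trans hg); rewrite ler_pM2l.
  split.
    rewrite ger0_norm; last by rewrite divr_ge0 ?sqr_ge0// ltW// gauss_gt0.
    have -> : 4 * C / W * invsq R n = C * (2 * invsq R n) * (2 / W) by ring.
    by apply: ler_pM => //; [rewrite ltW// gauss_gt0|rewrite invr_ge0 sqr_ge0].
  have -> : C * (1 + 2 / W) * 2 * invsq R n = C * (2 * invsq R n) * (1 + 2 / W) by ring.
  rewrite normrM; apply: ler_pM => //; first by apply: (le_trans hd); rewrite ler_pM2l.
  apply: (@le_trans _ _ (1 + ((z - p) ^+ 2)^-1)); last by rewrite lerD2l.
  rewrite -exprVn -real_normK ?num_real//; move: `|(z - p)^-1| => x.
  have : 0 <= (x - 1) ^+ 2 by rewrite sqr_ge0.
  by nra.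
have hy n := dom (y n) n (node_ge1 R e_le1 n) (wy z n).
have hnu' n : sin (pi * (z - - nu n)) ^+ 2 = w z ^+ 2 by rewrite opprK wnu.
have hN n : (1 + (- nu n) ^+ 2)^-1 <= 2 * invsq R n by rewrite sqrrN node_ge2.
have hnu n := dom (- nu n) n (hN n) (hnu' n).
have cap := @cvg_series_invsq_dom R (fun n => g (y n) / (z - y n) ^+ 2) _ (fun n => (hy n).1).
have cbp := @cvg_series_invsq_dom R (fun n => dg (y n) / (z - y n)) _ (fun n => (hy n).2).
have can := @cvg_series_invsq_dom R (fun n => g (- nu n) / (z - - nu n) ^+ 2) _ (fun n => (hnu n).1).
have cbn := @cvg_series_invsq_dom R (fun n => dg (- nu n) / (z - - nu n)) _ (fun n => (hnu n).2).
(* The two lists of nonnegative nodes must give the same limit: they coincide for e = 1, and for e =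
   0 they differ by the node 0, whose term is 0. *)
have cc : series (fun n => dg (nu n) / (z - nu n)) M @[M --> \oo] -->
    limn (series (fun n => dg (y n) / (z - y n))).
  have [e1|e0] : e = 1%N \/ e = 0%N by move: e_le1; case: (e) => [|[|//]]; [right|left].
    have -> : (fun n => dg (nu n) / (z - nu n)) = (fun n => dg (y n) / (z - y n)).
      apply/funext => n; have -> : nu n = y n by rewrite /nu /y e1 -natr1; field.
      by [].
    exact: cbp.
  have -> : series (fun n => dg (nu n) / (z - nu n)) =
      (fun M => series (fun n => dg (y n) / (z - y n)) M.+1).
    apply/funext => M; rewrite /series/= !big_mkord big_ord_recl/=.
    have -> : dg (y 0) = 0 by rewrite dgE /y e0 mul0r addr0 mulr0 mul0r.
    rewrite mul0r add0r; apply: eq_bigr => n _.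
    by have -> : nu n = y (bump 0 n) by rewrite /nu /y e0 mul0r subr0 addr0.
  exact: (eq_ind_r (fun P : Prop => P) cbp (cvg_shiftS (series (fun n => dg (y n) / (z - y n))) _)).
have -> : hermite_formula z = W * ((limn (series (fun n => g (y n) / (z - y n) ^+ 2)) +
    limn (series (fun n => g (- nu n) / (z - - nu n) ^+ 2))) +
   (limn (series (fun n => dg (y n) / (z - y n))) +
    limn (series (fun n => dg (- nu n) / (z - - nu n))))).
  have Ea : (fun n => g ((Negz n)%:~R + x0) / (z - ((Negz n)%:~R + x0)) ^+ 2) =
      (fun n => g (- nu n) / (z - - nu n) ^+ 2).
    by apply/funext => n; rewrite Negz_node.
  have Eb : (fun n => dg ((Negz n)%:~R + x0) / (z - ((Negz n)%:~R + x0))) =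
      (fun n => dg (- nu n) / (z - - nu n)).
    by apply/funext => n; rewrite Negz_node.
  by rewrite /hermite_formula /sumZ Ea Eb.
have -> : (fun M => part M z) = (fun M => W * (
   (series (fun n => g (y n) / (z - y n) ^+ 2) M +
    series (fun n => g (- nu n) / (z - - nu n) ^+ 2) M) +
   (series (fun n => dg (nu n) / (z - nu n)) M +
    series (fun n => dg (- nu n) / (z - - nu n)) M))).
  apply/funext => M; rewrite /part /series/= !big_mkord mulrDr -[in RHS]big_split -[X in _ = _ + W * X]big_split/= !mulr_sumr.
  congr (_ + _); apply: eq_bigr => n _.
    have [_ S1 _] := away _ (wy z n); have [_ S2 _] := away _ (hnu' n).
    by rewrite S1 -[X in sincsq (z + X)]opprK S2; ring.
  have hnu1 : sin (pi * (z - nu n)) ^+ 2 = w z ^+ 2 by rewrite nuE wnu.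
  have [_ _ S1] := away _ hnu1; have [_ _ S2] := away _ (hnu' n).
  have -> : dg (nu n) / pi ^+ 2 * (sinv (z - nu n) - sinv (z + nu n)) =
      dg (nu n) * (sinv (z - nu n) / pi ^+ 2 - sinv (z - - nu n) / pi ^+ 2).
    by rewrite opprK; ring.
  rewrite S1 S2 dgN; ring.
apply: cvgM; first exact: cvg_cst.
by apply: cvgD; apply: cvgD.
Qed.

(** The nodes are left out as a countable null set; off them [f] is the limit of [part], dominated
    by [part_le]. *)
Lemma has_integral_hermite (f : R -> R) :
  (forall z, sin (pi * (z - x0)) != 0 -> f z = hermite_formula z) ->
  has_integral mu f (limn (series (lattice_gauss delta e))).
Proof.
move=> fE; pose N := [set z : R | w z = 0].
have cN : countable N.
  apply: (@sub_countable _ _ _ [set: int]); last exact: countableP.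
  apply: (card_le_trans (subset_card_le _) (card_image_le (fun k : int => k%:~R + x0) setT)).
  move=> z /= /sin_pi_eq0 zE; exists (Num.floor (z - x0)) => //.
  by rewrite -zE subrK.
have mN : measurable (N : set (measurableTypeR R)).
  by apply: countable_measurable => // t; exact: measurable_set1.
have mf : measurable_fun [set: measurableTypeR R] (f : measurableTypeR R -> R).
  apply: (measurable_fun_off_countable cN).
  apply: (@measurable_fun_cvg _ (measurableTypeR R) _ _ part).
    move=> M; apply: measurable_funTS; exact: has_integral_measurable (has_part M).
  by move=> z /eqP wz; rewrite fE//; exact: cvg_part.
have [C HC] := part_le.
have [] := @has_integral_dct _ _ _ mu N part _ f (fun z => C * (1 + z ^+ 2)^-1)
   mN (countable_lebesgue_measure0 cN) has_part mf.
- by move=> z /eqP wz; rewrite fE//; exact: cvg_part.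
- by move=> M z _; exact: HC.
- exact: (has_integralZ _ (integrable_has_integral (integrable_oneDsqrV R))).1.
move=> [If _] L; split => //.
apply: cvg_unique L _; first exact: Rhausdorff.
have := cvg_lattice_gauss delta_gt0 e_le1.
by apply: cvg_trans; apply: near_eq_cvg; apply: nearW => M; rewrite /series/= big_mkord.
Qed.

End interpolation.

Section interpolants.
Variables (R : realType) (delta : R).
Hypothesis delta_gt0 : 0 < delta.
Notation mu := (@lebesgue_measure R).

Lemma has_integral_m : has_integral mu (m_ delta) ((Num.sqrt delta)^-1 * theta delta^-1 0).
Proof.
rewrite -poisson_gauss//; apply: has_integral_hermite => // z.
rewrite mul0r subr0 => s0; rewrite /m_ ifN; last first.
  by apply: contra_neqN s0 => /intrP[k ->]; exact: sin_pi_int.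
rewrite /m_formula /hermite_formula mul0r subr0.
by congr (_ * (sumZ _ + sumZ _)); apply/funext => k; rewrite addr0.
Qed.

Lemma has_integral_l : has_integral mu (l_ delta) ((Num.sqrt delta)^-1 * theta delta^-1 1).
Proof.
rewrite -poisson_gauss//; apply: has_integral_hermite => // z.
rewrite mul1r => s0; rewrite /l_ ifN; last first.
  by apply: contra_neqN s0 => /intrP[k ->]; exact: sin_pi_int.
rewrite /l_formula /hermite_formula mul1r.
congr (_ * (sumZ _ + sumZ _)).
- rewrite !expr_div_n; congr (_ / _).
  have -> : pi * (z - 2^-1) = pi * z - pi / 2 by rewrite mulrBr.
  by rewrite sinBpihalf sqrrN.
- by apply/funext => k; rewrite opprD addrA.
- by apply/funext => k; rewrite opprD addrA.
Qed.

End interpolants.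

(** * Tensor products on R^d *)

Section product.
Context d1 d2 (T1 : measurableType d1) (T2 : measurableType d2) (R : realType).
Variables (m1 : {sigma_finite_measure set T1 -> \bar R})
  (m2 : {sigma_finite_measure set T2 -> \bar R}).

Lemma has_integral_prod2 (f : T1 -> R) (g : T2 -> R) a b :
  has_integral m1 f a -> has_integral m2 g b ->
  has_integral (m1 \x m2)%E (fun p => f p.1 * g p.2) (a * b).
Proof.
move=> fa gb; have mf := has_integral_measurable fa; have mg := has_integral_measurable gb.
have mh : measurable_fun [set: T1 * T2] (fun p => f p.1 * g p.2).
  by apply: measurable_funM; apply: measurableT_comp.
have mE : measurable_fun [set: T1 * T2] (EFin \o (fun p => f p.1 * g p.2)).
  exact/measurable_EFinP.
have gnorm := integrable_has_integral (integrable_norm gb.1).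
have fnorm := integrable_has_integral (integrable_norm fa.1).
have int_eq (h : T2 -> R) c : has_integral m2 h c -> (\int[m2]_y (h y)%:E = c%:E)%E.
  by move=> [Ih <-]; rewrite /Rintegral fineK//; exact: integrable_fin_num.
have int_eq1 (h : T1 -> R) c : has_integral m1 h c -> (\int[m1]_y (h y)%:E = c%:E)%E.
  by move=> [Ih <-]; rewrite /Rintegral fineK//; exact: integrable_fin_num.
have Ih : (m1 \x m2)%E.-integrable [set: T1 * T2] (EFin \o (fun p => f p.1 * g p.2)).
  apply/integrable12ltyP => //=.
  set c := Rintegral m2 setT _ in gnorm.
  have -> : (\int[m1]_x \int[m2]_y `|(f x * g y)%:E| = \int[m1]_x (c * `|f x|)%:E)%E.
    apply: eq_integral => x _; rewrite [(c * _)%R]mulrC -(int_eq _ _ (has_integralZ `|f x| gnorm))//.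
    by apply: eq_integral => y _; rewrite /= normrM.
  by rewrite (int_eq1 _ _ (has_integralZ c fnorm)) ltry.
split => //; rewrite /Rintegral -integral12_prod_meas1//.
have -> : (\int[m1]_x fubini_F m2 (EFin \o (fun p => (f p.1 * g p.2)%R)) x = \int[m1]_x (b * f x)%:E)%E.
  apply: eq_integral => x _; rewrite /fubini_F /= (int_eq _ _ (has_integralZ (f x) gb)).
  by rewrite mulrC.
by rewrite (int_eq1 _ _ (has_integralZ b fa)) /= mulrC.
Qed.

End product.

Section tensor.
Variable R : realType.
Notation mu := (@lebesgue_measure R).

Let split_tuple n (x : borelRn R n.+1) : measurableTypeR R * borelRn R n :=
  (thead x, [tuple of behead x]).

Let measurable_split_tuple n : measurable_fun [set: borelRn R n.+1] (@split_tuple n).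
Proof.
by apply/measurable_fun_pairP; split => /=; [exact: measurable_tnth|exact: measurable_behead].
Qed.

Lemma has_integral_borelRn n (f : 'I_n -> R -> R) (v : 'I_n -> R) :
  (forall j, has_integral mu (f j) (v j)) ->
  has_integral (borel_lebesgueRn R n) (fun x : borelRn R n => \prod_(j < n) f j (tnth x j))
    (\prod_(j < n) v j).
Proof.
elim: n f v => [|n IH] f v fv.
  have -> : (fun x : borelRn R 0 => \prod_(j < 0) f j (tnth x j)) = cst 1.
    by apply/funext => x; rewrite big_ord0.
  rewrite big_ord0; split.
    apply: measurable_bounded_integrable => //.
      by rewrite /= diracT ltry.
    by exists 1; split => // M M1 x _ /=; rewrite normr1 ltW.
  by rewrite /Rintegral /= integral_dirac// diracE in_setT mul1e.
have H := has_integral_prod2 (fv ord0) (IH (fun j => f (lift ord0 j)) (fun j => v (lift ord0 j))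
  (fun j => fv (lift ord0 j))).
have m12 A : measurable A -> (mu \x borel_lebesgueRn R n)%E A =
    (1%:E * borel_lebesgueRn R n.+1 (@split_tuple n @^-1` A))%E.
  move=> mA; rewrite mul1e /= /stepRn /pushforward.
  have consK p : split_tuple (@consRn R n p) = p.
    by case: p => a b; rewrite /split_tuple theadE; congr pair; apply/val_inj.
  by congr ((_ \x _)%E _); apply/funext => p; rewrite -[in LHS](consK p).
have := has_integral_transport ltr01 (@measurable_split_tuple n) m12 H.
apply: has_integral_eq => [x|]; last by rewrite divr1 big_ord_recl.
rewrite big_ord_recl /=; congr (_ * _); apply: eq_bigr => j _.
by congr (f _ _); rewrite !(tnth_nth 0) /= nth_behead.
Qed.

(** Borel sets are Carathéodory measurable, so integrals of products computed for the Borel measure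
    transfer to [lebesgueRn]. *)
Lemma measurable_Rn_borelRn n : measurable_fun [set: Rn R n] (fun x : Rn R n => (x : borelRn R n)).
Proof.
move=> _ A mA; rewrite setTI.
exact: caratheodory_measurable_mu_ext.
Qed.

Lemma lebesgueRn_borel n (A : set (borelRn R n)) : measurable A ->
  lebesgueRn (A : set (Rn R n)) = borel_lebesgueRn R n A.
Proof. by move=> mA; rewrite /lebesgueRn /completed_measure_extension measurable_mu_extE. Qed.

Lemma has_integral_prodRn n (f : 'I_n -> R -> R) (v : 'I_n -> R) :
  (forall j, has_integral mu (f j) (v j)) ->
  has_integral (@lebesgueRn R n) (fun x : Rn R n => \prod_(j < n) f j (coordRn x j))
    (\prod_(j < n) v j).
Proof.
move=> /has_integral_borelRn fv.
have := @has_integral_transport _ _ (Rn R n) (borelRn R n) R (fun x => x)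
  (@lebesgueRn R n) (borel_lebesgueRn R n) 1 ltr01 (@measurable_Rn_borelRn n) _ _ _ fv.
rewrite divr1; apply => A mA.
by rewrite mul1e; apply/esym; exact: lebesgueRn_borel.
Qed.

Lemma measurable_coordRn n (j : 'I_n) : measurable_fun [set: Rn R n]
  (fun x : Rn R n => (coordRn x j : measurableTypeR R)).
Proof.
apply: (@measurableT_comp _ _ _ (Rn R n) (borelRn R n) (measurableTypeR R) (fun x => tnth x j)).
  exact: measurable_tnth.
exact: measurable_Rn_borelRn.
Qed.

End tensor.

(** * The upper bound *)

Section complex_exponentials.
Variable R : realType.
Implicit Types (a b c d t x y : R).

Lemma mul_Complex a b c d :
  Complex a b * Complex c d = Complex (a * c - b * d) (a * d + b * c) :> R[i].
Proof. by []. Qed.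

Lemma natr_Complex n : n%:R = Complex n%:R 0 :> R[i].
Proof. by rewrite -(rmorph_nat (real_complex R)). Qed.

Definition cis x : R[i] := Complex (cos x) (sin x).

Lemma cisD x y : cis (x + y) = cis x * cis y.
Proof. by rewrite /cis mul_Complex cosD sinD [sin x * _ + _]addrC. Qed.

Lemma cis0 : cis 0 = 1.
Proof. by rewrite /cis cos0 sin0. Qed.

Lemma cexp_im t : cexp (Complex 0 t) = cis t.
Proof. by rewrite /cexp /= expR0 !mul1r. Qed.

(** With vanishing sine sums, every sum of cosines is a sum of exponentials, whose product expands
    by distributivity and adds the phases; the real part is the claim. *)
Lemma prod_sum_cos (I P : finType) (theta : I -> P -> R) :
  (forall i, \sum_p sin (theta i p) = 0) ->
  \prod_i \sum_p cos (theta i p) = \sum_(f : {ffun I -> P}) cos (\sum_i theta i (f i)).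
Proof.
move=> s0.
have cis_sum (Q : finType) (h : Q -> R) :
    \sum_q cis (h q) = Complex (\sum_q cos (h q)) (\sum_q sin (h q)).
  elim: (index_enum Q) => [|q r IH]; first by rewrite !big_nil.
  by rewrite !big_cons IH.
have E : \prod_i \sum_p cis (theta i p) = (\prod_i \sum_p cos (theta i p))%:C%C.
  rewrite rmorph_prod; apply: eq_bigr => i _.
  by rewrite cis_sum s0.
have : \prod_i \sum_p cis (theta i p) = \sum_(f : {ffun I -> P}) \prod_i cis (theta i (f i)).
  exact: bigA_distr_bigA.
rewrite E.
have -> : \sum_(f : {ffun I -> P}) \prod_i cis (theta i (f i)) =
    \sum_(f : {ffun I -> P}) cis (\sum_i theta i (f i)).
  by apply: eq_bigr => f _; rewrite (big_morph cis cisD cis0).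
by rewrite cis_sum => /(congr1 (@complex.Re R)).
Qed.

Lemma fourier_phase t : - 2 * pi%:C%C * ci R * t%:C%C = Complex 0 (- (2 * pi * t)).
Proof.
rewrite natr_Complex /ci -[pi%:C%C]/(Complex pi 0) -[t%:C%C]/(Complex t 0).
rewrite -[- _]/(Complex (- 2) (- 0)) !mul_Complex.
by congr Complex; ring.
Qed.

Lemma fourier_kernel t y : cexp (- 2 * pi%:C%C * ci R * t%:C%C) * y%:C%C =
  Complex (y * cos (2 * pi * t)) (- (y * sin (2 * pi * t))).
Proof.
rewrite fourier_phase cexp_im /cis cosN sinN -[y%:C%C]/(Complex y 0) mul_Complex.
by congr Complex; ring.
Qed.

Lemma cexp_theta (g : R) (k : int) :
  cexp (2 * pi%:C%C * ci R * k%:~R * 2^-1) *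
  cexp (pi%:C%C * ci R * (ci R * g%:C%C) * k%:~R ^+ 2) = (theta_term g 1 k%:~R)%:C%C.
Proof.
have kC : k%:~R = Complex k%:~R 0 :> R[i] by rewrite -(rmorph_int (real_complex R)).
have -> : 2 * pi%:C%C * ci R * k%:~R * 2^-1 = Complex 0 (pi * k%:~R).
  have -> : 2 * pi%:C%C * ci R * k%:~R * 2^-1 = pi%:C%C * ci R * k%:~R.
    rewrite mulrC !mulrA mulVf ?mul1r// pnatr_eq0.
  rewrite kC /ci -[pi%:C%C]/(Complex pi 0) !mul_Complex; congr Complex; ring.
have -> : pi%:C%C * ci R * (ci R * g%:C%C) * k%:~R ^+ 2 = Complex (- pi * (g * k%:~R ^+ 2)) 0.
  rewrite kC /ci -[pi%:C%C]/(Complex pi 0) -[g%:C%C]/(Complex g 0) expr2 !mul_Complex.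
  by congr Complex; ring.
rewrite cexp_im /cexp /= cos0 sin0 /cis sin_pi_int mulr1 mulr0 mul_Complex /theta_term.
rewrite mulr1; congr Complex; ring.
Qed.

Lemma Theta_half (g : R) : 0 < g ->
  Theta 2^-1 (ci R * g%:C%C) = (theta g 1)%:C%C.
Proof.
move=> g0; rewrite /Theta /csumZ.
under [X in Complex (sumZ X) _]eq_fun do rewrite cexp_theta /=.
under [X in Complex _ (sumZ X)]eq_fun do rewrite cexp_theta /=.
have cv := @cvg_theta R g 1 g0.
congr Complex; last first.
  rewrite /sumZ; have -> : [series (0 : R)]_n = cst 0.
    by apply/funext => n; rewrite /series/= big1.
  by rewrite lim_cst// addr0.
rewrite /sumZ /theta.
have -> : (fun n => theta_term g 1 (Negz n)%:~R) = (fun n => theta_term g 1 n.+1%:R).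
  by apply/funext => n; rewrite NegzE mulrNz theta_termN.
(* The series over n >= 0 starts with the term 1 at n = 0, while the one over n < 0 starts at -1. *)
have -> : limn [series theta_term g 1 (Posz n)%:~R]_n =
    1 + limn (series (fun n => theta_term g 1 n.+1%:R)).
  apply: cvg_lim => //; rewrite -cvg_shiftS.
  have -> : [sequence [series theta_term g 1 (Posz n)%:~R]_n n.+1]_n =
     (fun n => 1 + series (fun n => theta_term g 1 n.+1%:R) n).
    apply/funext => n /=; rewrite /series/= !big_mkord big_ord_recl/=.
    by rewrite theta_term0.
  by apply: cvgD; [exact: cvg_cst|exact: cv].
ring.
Qed.

End complex_exponentials.

(** * Testing F against the product of Fejér kernels *)

Section upper_bound.
Variables (R : realType) (d : nat).
Notation leb := (@lebesgueRn R d).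

Lemma cvg_prod_seq I (r : seq I) (u : I -> nat -> R) (v : I -> R) :
  (forall i, u i n @[n --> \oo] --> v i) ->
  \prod_(i <- r) u i n @[n --> \oo] --> \prod_(i <- r) v i.
Proof.
move=> uv; elim: r => [|i r IH].
  rewrite big_nil (_ : (fun n => _) = cst 1); first exact: cvg_cst.
  by apply/funext => n; rewrite big_nil.
rewrite big_cons (_ : (fun n => _) = (fun n => u i n * \prod_(j <- r) u j n)).
  exact: cvgM.
by apply/funext => n; rewrite big_cons.
Qed.

Lemma cvg_sum_seq I (r : seq I) (u : I -> nat -> R) (v : I -> R) :
  (forall i, u i n @[n --> \oo] --> v i) ->
  \sum_(i <- r) u i n @[n --> \oo] --> \sum_(i <- r) v i.
Proof.
move=> uv; elim: r => [|i r IH].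
  rewrite big_nil (_ : (fun n => _) = cst 0); first exact: cvg_cst.
  by apply/funext => n; rewrite big_nil.
rewrite big_cons (_ : (fun n => _) = (fun n => u i n + \sum_(j <- r) u j n)).
  exact: cvgD.
by apply/funext => n; rewrite big_cons.
Qed.

Lemma le_cvg_nat (u : nat -> R) (l b : R) : u n @[n --> \oo] --> l ->
  (forall n, b <= u n) -> b <= l.
Proof.
move=> ul h; rewrite -(cvg_lim _ ul)//; apply: limr_ge; last exact: nearW.
by apply/cvg_ex; eexists; exact: ul.
Qed.

Lemma measurable_dotRn (xi : Rn R d) :
  measurable_fun [set: Rn R d] (fun x : Rn R d => (dotRn x xi : measurableTypeR R)).
Proof.
rewrite /dotRn; apply: measurable_sum => j; apply: measurable_funM.
  exact: measurable_coordRn.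
exact: measurable_cst.
Qed.

Lemma integrable_bounded_mul (F h : Rn R d -> R) : integrableRn F ->
  measurable_fun [set: Rn R d] h -> (forall x, `|h x| <= 1) ->
  leb.-integrable [set: Rn R d] (EFin \o (fun x => F x * h x)).
Proof.
move=> If mh h1.
apply: (@integrable_dominated _ _ _ _ _ (fun x => `|F x|)).
- apply: measurable_funM; last exact: mh.
  exact/measurable_EFinP/(measurable_int _ If).
- by move=> x; rewrite normrM ler_piMr.
- exact: (integrable_norm If).
Qed.

(** As F is real, a zero of its transform annihilates both the cosine and the sine integral, hence
    the cosine integral with any phase; [c] will come from the shift by 1/2. *)
Lemma fourier_eq0 (F : Rn R d -> R) (xi : Rn R d) (c : R) : integrableRn F ->
  fourier F xi = 0 ->
  has_integral leb (fun x => F x * cos (2 * pi * dotRn x xi - c)) 0.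
Proof.
move=> If; rewrite /fourier /cintegralRn.
under [X in Complex (integralRn X) _]eq_fun do rewrite fourier_kernel /=.
under [X in Complex _ (integralRn X)]eq_fun do rewrite fourier_kernel /=.
move=> [Re0 Im0].
have mt : measurable_fun [set: Rn R d] (fun x : Rn R d => (2 * pi * dotRn x xi : measurableTypeR R)).
  by apply: measurable_funM; [exact: measurable_cst|exact: measurable_dotRn].
have mc : measurable_fun [set: Rn R d] (fun x : Rn R d => cos (2 * pi * dotRn x xi)).
  by apply: (measurableT_comp (@measurable_continuous R _ (@continuous_cos R)) mt).
have ms : measurable_fun [set: Rn R d] (fun x : Rn R d => sin (2 * pi * dotRn x xi)).
  by apply: (measurableT_comp (@measurable_continuous R _ (@continuous_sin R)) mt).
have Hc : has_integral leb (fun x => F x * cos (2 * pi * dotRn x xi)) 0.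
  by split => //; apply: integrable_bounded_mul => // x; exact: cos_max.
have Hs : has_integral leb (fun x => F x * sin (2 * pi * dotRn x xi)) 0.
  have Is := integrable_has_integral (integrable_bounded_mul If ms (fun x => sin_max _)).
  have [_ E] := has_integralZ (-1) Is.
  suff S0 : Rintegral leb setT (fun x => F x * sin (2 * pi * dotRn x xi)) = 0 by rewrite S0 in Is.
  move: E; rewrite mulN1r => /eqP; rewrite -eqr_oppLR => /eqP <-.
  apply/eqP; rewrite oppr_eq0; apply/eqP; rewrite -[RHS]Im0.
  by apply: eq_Rintegral => x _; rewrite mulN1r.
have := has_integralD (has_integralZ (cos c) Hc) (has_integralZ (sin c) Hs).
apply: has_integral_eq => [x|]; last by rewrite !mulr0 addr0.
by rewrite cosB; ring.
Qed.

Lemma norm_natB_ge1 (m n : nat) : m != n -> 1 <= `|m%:R - n%:R| :> R.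
Proof.
wlog mn : m n / (n < m)%N => [H mn|_].
  by case: (ltngtP m n) mn => // h _; [rewrite distrC|]; apply: H => //; rewrite gtn_eqF.
by rewrite -natrB ?(ltnW mn)// normr_nat ler1n subn_gt0.
Qed.

Lemma fejer_pair N (t : R) :
  fejer N t = N%:R^-1 * \sum_(p : 'I_N * 'I_N) cos (2 * pi * ((p.1)%:R - (p.2)%:R) * t).
Proof. by rewrite /fejer pair_bigA. Qed.

Lemma sum_sin_pair N (t : R) :
  \sum_(p : 'I_N * 'I_N) sin (2 * pi * ((p.1)%:R - (p.2)%:R) * t) = 0.
Proof.
have := pair_bigA +%R (fun k l : 'I_N => sin (2 * pi * (k%:R - l%:R) * t)) => /= <-.
set S := (X in X = 0).
suff : S = - S by move=> h; clearbody S; lra.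
rewrite /S [in LHS]exchange_big -sumrN; apply: eq_bigr => k _ /=.
rewrite -sumrN; apply: eq_bigr => l _; rewrite -sinN; congr sin; ring.
Qed.

Lemma has_integral_band_limited (a b : Rn R d) (F : Rn R d -> R) N :
  Lambda a -> (forall j, coordRn a j < coordRn b j) -> integrableRn F ->
  (forall xi : Rn R d, ~ boxQ a xi -> fourier F xi = 0) ->
  has_integral leb (fun x => F x * \prod_(j < d) fejer N.+1 (coordRn b j * coordRn x j - 1%:R / 2))
    (integralRn F).
Proof.
move=> La ab IF F0.
pose kap (p : 'I_N.+1 * 'I_N.+1) : R := (p.1)%:R - (p.2)%:R.
(* Expanding the product gives one cosine for each choice [f] of an index pair per coordinate, with
   frequency [xi f] and phase [c f]. *)
pose xi (f : {ffun 'I_d -> 'I_N.+1 * 'I_N.+1}) : Rn R d := [tuple kap (f j) * coordRn b j | j < d].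
have xiE f j : coordRn (xi f) j = kap (f j) * coordRn b j by rewrite /coordRn tnth_mktuple.
pose c (f : {ffun 'I_d -> 'I_N.+1 * 'I_N.+1}) : R := \sum_(j < d) pi * kap (f j).
have H f : has_integral leb (fun x => F x * cos (2 * pi * dotRn x (xi f) - c f))
   ((\prod_(j < d) ((f j).1 == (f j).2)%:R) * integralRn F).
  have [/forallP diag|] := boolP [forall j, (f j).1 == (f j).2].
    have k0 j : kap (f j) = 0 by rewrite /kap (eqP (diag j)) subrr.
    rewrite big1 ?mul1r => [|j _]; last by rewrite diag.
    apply: has_integral_eq (integrable_has_integral IF) => // x.
    rewrite /c big1 => [|j _]; last by rewrite k0 mulr0.
    rewrite subr0 /dotRn big1 => [|j _]; last by rewrite xiE k0 mul0r mulr0.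
    by rewrite mulr0 cos0 mulr1.
  rewrite negb_forall => /existsP[j jf].
  rewrite (bigD1 j)//= (negbTE jf) !mul0r; apply: fourier_eq0 => //; apply: F0.
  (* A nonzero integer multiple of b_j exceeds a_j in absolute value, because a_j < b_j. *)
  move=> /(_ j); rewrite xiE => /andP[h1 h2].
  have k1 : 1 <= `|kap (f j)|.
    exact: norm_natB_ge1.
  have b0 : 0 < coordRn b j by apply: lt_trans (ab j); exact: La.
  have : `|kap (f j) * coordRn b j| <= coordRn a j by rewrite ler_norml h1 h2.
  rewrite normrM (gtr0_norm b0) => h3.
  have := ab j; rewrite ltNge => /negP; apply; apply: le_trans h3.
  by rewrite ler_peMl// ltW.
have := has_integralZ (N.+1%:R^-1 ^+ d) (has_integral_sum (index_enum _) H).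
apply: has_integral_eq => [x|].
  under [in RHS]eq_bigr do rewrite fejer_pair.
  rewrite big_split/= prodr_const card_ord mulrCA; congr (_ * _).
  rewrite -mulr_sumr; congr (_ * _).
  rewrite (@prod_sum_cos R 'I_d ('I_N.+1 * 'I_N.+1)%type
     (fun j p => 2 * pi * (p.1%:R - p.2%:R) * (coordRn b j * coordRn x j - 1%:R / 2))); last first.
    by move=> j; exact: sum_sin_pair.
  apply: eq_bigr => f _; congr cos.
  rewrite /dotRn /c mulr_sumr -sumrB; apply: eq_bigr => j _.
  by rewrite xiE /kap; move: (pi : R) => p; field.
rewrite -mulr_suml.
(* The coefficients factor over the coordinates; each factor counts the N + 1 diagonal pairs and
   cancels the normalisation. *)
have <- : \prod_(j < d) \sum_(p : 'I_N.+1 * 'I_N.+1) (p.1 == p.2)%:R =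
  \sum_(f : {ffun 'I_d -> 'I_N.+1 * 'I_N.+1}) \prod_(j < d) ((f j).1 == (f j).2)%:R :> R.
  exact: bigA_distr_bigA.
rewrite mulrA; have -> : N.+1%:R^-1 ^+ d * \prod_(j < d) \sum_(p : 'I_N.+1 * 'I_N.+1) (p.1 == p.2)%:R = 1 :> R.
  have D : \sum_(p : 'I_N.+1 * 'I_N.+1) (p.1 == p.2)%:R = N.+1%:R :> R.
    rewrite -(pair_bigA +%R (fun k l : 'I_N.+1 => (k == l)%:R))/=.
    rewrite (eq_bigr (fun=> 1)) => [|k _]; first by rewrite sumr_const card_ord.
    rewrite (bigD1 k)//= eqxx big1 ?addr0// => l lk.
    by rewrite eq_sym (negbTE lk).
  under eq_bigr do rewrite D.
  by rewrite prodr_const card_ord -exprMn mulVf ?expr1n// pnatr_eq0.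
by rewrite mul1r.
Qed.

Lemma integral_le_theta_mean (a b l : Rn R d) (F : Rn R d -> R) N :
  Lambda a -> (forall j, coordRn a j < coordRn b j) -> Lambda l -> integrableRn F ->
  (forall x, F x <= Gauss l x) ->
  (forall xi : Rn R d, ~ boxQ a xi -> fourier F xi = 0) ->
  integralRn F <= \prod_(j < d) ((Num.sqrt (coordRn l j))^-1 *
    theta_mean (coordRn b j ^+ 2 / coordRn l j) 1 N.+1).
Proof.
move=> La ab Ll IF FG F0.
have HF := has_integral_band_limited N La ab IF F0.
have HG := has_integral_prodRn (fun j => gauss_fejer (coordRn b j) 1 N.+1 (Ll j)).
apply: has_integral_le HF HG => x; rewrite [leRHS]big_split/=.
apply: ler_wpM2r; last exact: FG.
by apply: prodr_ge0 => j _; exact: fejer_ge0.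
Qed.

Theorem integral_le_theta (a l : Rn R d) (F : Rn R d -> R) :
  Lambda a -> Lambda l -> integrableRn F ->
  (forall x, F x <= Gauss l x) ->
  (forall xi : Rn R d, ~ boxQ a xi -> fourier F xi = 0) ->
  integralRn F <= \prod_(j < d) ((Num.sqrt (coordRn l j))^-1 *
    theta (coordRn a j ^+ 2 / coordRn l j) 1).
Proof.
move=> La Ll IF FG F0.
pose b n : Rn R d := [tuple (1 + n.+1%:R^-1) * coordRn a j | j < d].
have bE n j : coordRn (b n) j = (1 + n.+1%:R^-1) * coordRn a j by rewrite /coordRn tnth_mktuple.
have cb j : coordRn (b n) j @[n --> \oo] --> coordRn a j.
  have -> : (fun n => coordRn (b n) j) = (fun n => (1 + n.+1%:R^-1) * coordRn a j) := funext (bE ^~ j).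
  rewrite -[X in _ --> X]mul1r; apply: cvgM; last exact: cvg_cst.
  rewrite -[X in _ --> X]addr0; apply: cvgD; first exact: cvg_cst.
  exact: cvg_harmonic.
(* For fixed N the bound is a finite product of finite sums, each continuous in b, so b may tend to
   a before N grows. *)
have step N : integralRn F <= \prod_(j < d) ((Num.sqrt (coordRn l j))^-1 *
    theta_mean (coordRn a j ^+ 2 / coordRn l j) 1 N.+1).
  apply: (@le_cvg_nat (fun n => \prod_(j < d) ((Num.sqrt (coordRn l j))^-1 *
    theta_mean (coordRn (b n) j ^+ 2 / coordRn l j) 1 N.+1))).
    apply: cvg_prod_seq => j; apply: cvgM; first exact: cvg_cst.
    apply: cvgM; first exact: cvg_cst.
    apply: cvg_sum_seq => k; apply: cvg_sum_seq => m.
    apply: cvgM; last exact: cvg_cst.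
    apply: continuous_cvg; first exact: continuous_expR.
    apply: cvgM; first exact: cvg_cst.
    apply: cvgM; last exact: cvg_cst.
    apply: cvgM; last exact: cvg_cst.
    exact: (cvgM (cb j) (cb j)).
  move=> n; apply: integral_le_theta_mean => // j.
  by rewrite bE ltr_pMl ?La// ltrDl invr_gt0 ltr0n.
apply: (@le_cvg_nat (fun N => \prod_(j < d) ((Num.sqrt (coordRn l j))^-1 *
    theta_mean (coordRn a j ^+ 2 / coordRn l j) 1 N.+1))) => //.
apply: cvg_prod_seq => j; apply: cvgM; first exact: cvg_cst.
by apply: cvg_theta_mean; rewrite divr_gt0 ?exprn_gt0 ?La// Ll.
Qed.

End upper_bound.

(** * The lower bound *)

Section theta_estimates.
Variable R : realType.
Implicit Types g : R.

Let nome g : R := expR (- pi * g).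

Lemma theta_term_le_geometric g e n : 0 <= g ->
  `|theta_term g e n.+1%:R| <= nome g * nome g ^+ n.
Proof.
move=> g0; rewrite /theta_term normrM (ger0_norm (expR_ge0 _)).
apply: (@le_trans _ _ (expR (- pi * (g * n.+1%:R ^+ 2)))).
  by rewrite ler_piMr ?expR_ge0// cos_max.
rewrite -exprS /nome -expRM_natl ler_expR !mulNr mulrN lerN2.
rewrite mulrC -mulrA ler_wpM2l ?pi_ge0// ler_wpM2l//.
by rewrite ler_eXnr// ler1n.
Qed.

(** Comparison with a geometric series gives 2 q / (1 - q), and 1 - q >= 8/9 when q <= 1/9. *)
Lemma theta_near1 g e : 0 < g -> nome g <= 9^-1 -> `|theta g e - 1| <= 9 / 4 * nome g.
Proof.
move=> g0 q9; have q0 : 0 < nome g by exact: expR_gt0.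
rewrite /theta addrC addKr normrM ger0_norm//.
have q1 : `|nome g| < 1 by rewrite gtr0_norm//; lra.
have cG := @cvg_geometric_series R (nome g) (nome g) q1.
have cV := @cvg_theta R g e g0.
have Z : cst (0 : R) n @[n --> \oo] --> (0 : R) by exact: cvg_cst.
have H : `|limn (series (fun n => theta_term g e n.+1%:R)) - 0| <= nome g * (1 - nome g)^-1.
  apply: (cvg_dist_le cV Z) => n; rewrite subr0.
  apply: (@le_trans _ _ (series (geometric (nome g) (nome g)) n)).
    rewrite /series/= !big_mkord; apply: (le_trans (ler_norm_sum _ _ _)).
    by apply: ler_sum => i _; apply: theta_term_le_geometric; exact: ltW.
  rewrite -(cvg_lim _ cG)//; apply: nondecreasing_cvgn_le; last by apply/cvg_ex; eexists; exact: cG.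
  by apply/nondecreasing_seqP => m; rewrite seriesSr lerDl mulr_ge0 ?exprn_ge0// ltW.
rewrite subr0 in H.
have h2 : nome g * (1 - nome g)^-1 <= 9 / 8 * nome g.
  rewrite ler_pdivrMr; last by lra.
  by nra.
lra.
Qed.

Lemma theta1_le_theta0 g : 0 < g -> theta g 1 <= theta g 0.
Proof.
move=> g0; rewrite /theta lerD2l ler_pM2l//.
apply: lim_series_le; [exact: cvg_theta|exact: cvg_theta|move=> n].
rewrite /theta_term ler_wpM2l ?expR_ge0// mulr0 cos0; exact: cos_le1.
Qed.

Lemma theta0_ge1 g : 0 < g -> 1 <= theta g 0.
Proof.
move=> g0; rewrite /theta lerDl mulr_ge0//; apply: limr_ge; first exact: cvg_theta.
apply: nearW => n; rewrite /series/= sumr_ge0// => i _.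
by rewrite /theta_term mulr0 cos0 mulr1 expR_ge0.
Qed.

Lemma theta1_ge0 g : 0 < g -> nome g <= 9^-1 -> 0 <= theta g 1.
Proof.
move=> g0 q9; have := theta_near1 1 g0 q9; rewrite ler_norml => /andP[h _].
by move: (nome g) q9 h => q q9 h; lra.
Qed.

(** The two errors (9/4) q add up, and the division by theta g 0 >= 1 does not increase them. *)
Lemma theta_ratio g : 0 < g -> nome g <= 9^-1 ->
  1 - theta g 1 / theta g 0 <= 9 / 2 * nome g.
Proof.
move=> g0 q9; have t1 := theta0_ge1 g0.
have t0 : 0 < theta g 0 by rewrite (lt_le_trans ltr01).
have := theta_near1 0 g0 q9; have := theta_near1 1 g0 q9.
rewrite !ler_norml => /andP[h1 _] /andP[_ h2].
have q0 : 0 <= nome g by exact: expR_ge0.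
rewrite -[X in X - _](divff (lt0r_neq0 t0)) -mulrBl ler_pdivrMr//.
by move: (theta g 0) (theta g 1) (nome g) q0 q9 t1 t0 h1 h2 => t p q q0 q9 t1 t0 h1 h2; nra.
Qed.

(** Put x = d Q. With the common factor M taken out, the left side is at most M and the bracket at
    least M (1 - (9/2) x); and (1 + 5 x) (1 - (9/2) x) >= 1 for 0 <= x <= 1/45, which x <= 1/100
    ensures. *)
Lemma prod_le_linearized d (c p t q : 'I_d -> R) (Q : R) :
  (forall j, 0 < c j) -> (forall j, 0 <= p j <= t j) -> (forall j, 1 <= t j) ->
  (forall j, 1 - p j / t j <= 9 / 2 * q j) -> (forall j, q j <= Q) -> 0 <= Q ->
  d%:R * Q <= 100^-1 ->
  \prod_(j < d) (c j * p j) <= (1 + 5 * d%:R * Q) *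
    (- (d%:R - 1) * (\prod_(j < d) (c j * t j)) +
     \sum_(k < d) (c k * p k) * \prod_(j < d | j != k) (c j * t j)).
Proof.
move=> c0 pt t1 rq qQ Q0 dQ.
have t0 j : 0 < t j by rewrite (lt_le_trans ltr01).
set M := \prod_(j < d) (c j * t j).
have M0 : 0 < M by apply: prodr_gt0 => j _; rewrite mulr_gt0.
have -> : \sum_(k < d) (c k * p k) * \prod_(j < d | j != k) (c j * t j) =
    M * \sum_(k < d) (p k / t k).
  rewrite mulr_sumr; apply: eq_bigr => k _; rewrite /M [in RHS](bigD1 k)//=.
  by field; rewrite gt_eqF.
have S : d%:R - \sum_(k < d) (p k / t k) <= 9 / 2 * (d%:R * Q).
  have -> : d%:R = \sum_(k < d) (1 : R) by rewrite sumr_const card_ord.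
  rewrite -sumrB mulr_suml mulr_sumr; apply: ler_sum => k _.
  by rewrite mul1r (le_trans (rq k))// ler_wpM2l.
have P : \prod_(j < d) (c j * p j) <= M.
  apply: ler_prod => j _; have /andP[h1 h2] := pt j.
  by rewrite mulr_ge0 ?(ltW (c0 j))//= ler_pM2l.
apply: (le_trans P).
have dQ0 : 0 <= d%:R * Q by rewrite mulr_ge0.
have -> : - (d%:R - 1) * M + M * (\sum_(k < d) p k / t k) =
   M * (1 - (d%:R - \sum_(k < d) p k / t k)) by ring.
rewrite mulrCA -[leLHS]mulr1 ler_pM2l// -[5 * _ * _]mulrA.
by move: (d%:R * Q) dQ dQ0 (d%:R - _) S => x x1 x0 s sx; nra.
Qed.

End theta_estimates.

Section minorant_integral.
Variable R : realType.
Notation mu := (@lebesgue_measure R).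

Lemma scaled_constant (l a : R) e : 0 < l -> 0 < a ->
  (Num.sqrt (l / a ^+ 2))^-1 * theta (l / a ^+ 2)^-1 e / a =
  (Num.sqrt l)^-1 * theta (a ^+ 2 / l) e.
Proof.
move=> l0 a0; rewrite invf_div sqrtrM ?(ltW l0)// sqrtrV ?sqr_ge0// sqrtr_sqr gtr0_norm//.
have s0 : Num.sqrt l != 0 by rewrite gt_eqF// sqrtr_gt0.
by field; rewrite s0 gt_eqF.
Qed.

Lemma has_integral_m_scaled (l a : R) : 0 < l -> 0 < a ->
  has_integral mu (fun t => m_ (l / a ^+ 2) (a * t)) ((Num.sqrt l)^-1 * theta (a ^+ 2 / l) 0).
Proof.
move=> l0 a0; rewrite -scaled_constant//.
have d0 : 0 < l / a ^+ 2 by rewrite divr_gt0// exprn_gt0.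
by apply: has_integral_eq (has_integral_affine 0 a0 (has_integral_m d0)) => // t; rewrite addr0.
Qed.

Lemma has_integral_l_scaled (l a : R) : 0 < l -> 0 < a ->
  has_integral mu (fun t => l_ (l / a ^+ 2) (a * t)) ((Num.sqrt l)^-1 * theta (a ^+ 2 / l) 1).
Proof.
move=> l0 a0; rewrite -scaled_constant//.
have d0 : 0 < l / a ^+ 2 by rewrite divr_gt0// exprn_gt0.
by apply: has_integral_eq (has_integral_affine 0 a0 (has_integral_l d0)) => // t; rewrite addr0.
Qed.

Lemma has_integral_L_scaled d (l a : Rn R d) : Lambda a -> Lambda l ->
  has_integral (@lebesgueRn R d) (L_scaled l a)
  (- (d%:R - 1) * (\prod_(j < d) ((Num.sqrt (coordRn l j))^-1 * theta (coordRn a j ^+ 2 / coordRn l j) 0)) +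
   \sum_(k < d) ((Num.sqrt (coordRn l k))^-1 * theta (coordRn a k ^+ 2 / coordRn l k) 1) *
   \prod_(j < d | j != k) ((Num.sqrt (coordRn l j))^-1 * theta (coordRn a j ^+ 2 / coordRn l j) 0)).
Proof.
move=> La Ll.
have Hm := has_integral_prodRn (fun j => has_integral_m_scaled (Ll j) (La j)).
(* The factor at j is [l_] for j = k and [m_] otherwise; the dependent [if] carries the proof along
   with the function and its integral. *)
have Hk (k : 'I_d) := has_integral_prodRn (fun j =>
  if j == k as b return has_integral mu
    (fun t => if b then l_ (coordRn l j / coordRn a j ^+ 2) (coordRn a j * t)
      else m_ (coordRn l j / coordRn a j ^+ 2) (coordRn a j * t))
    (if b then (Num.sqrt (coordRn l j))^-1 * theta (coordRn a j ^+ 2 / coordRn l j) 1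
      else (Num.sqrt (coordRn l j))^-1 * theta (coordRn a j ^+ 2 / coordRn l j) 0)
  then has_integral_l_scaled (Ll j) (La j) else has_integral_m_scaled (Ll j) (La j)).
have := has_integralD (has_integralZ (- (d%:R - 1)) Hm) (has_integral_sum (index_enum 'I_d) Hk).
apply: has_integral_eq => [x|].
  rewrite /L_scaled /L_; congr (_ * _ + _).
    by apply: eq_bigr => j _; rewrite /coordRn !tnth_mktuple.
  apply: eq_bigr => k _; rewrite (bigD1 k)//= eqxx /coordRn !tnth_mktuple; congr (_ * _).
  by apply: eq_bigr => j /negbTE ->; rewrite !tnth_mktuple.
congr (_ + _); apply: eq_bigr => k _; rewrite (bigD1 k)//= eqxx; congr (_ * _).
by apply: eq_bigr => j /negbTE ->.
Qed.

Lemma min_ord_le d (f : 'I_d -> R) j : min_ord f <= f j.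
Proof. exact: bigmin_le_cond. Qed.

End minorant_integral.
(* Inequalities are in R[i], whose order is
   (x <= y) <-> (Im x = Im y /\ Re x <= Re y): they also assert that the values
   of Theta involved have a real product. *)
Theorem theorem2 (R : realType) (d : nat) (hd : (1 <= d)%N) :
  (forall (a l : Rn R d), Lambda a -> Lambda l ->
     forall F : Rn R d -> R, integrableRn F ->
       (forall x : Rn R d, F x <= Gauss l x) ->
       (forall xi : Rn R d, ~ boxQ a xi -> fourier F xi = 0) ->
       (integralRn F)%:C%C <=
         \prod_(j < d) (((coordRn l j) `^ (- 2^-1))%:C%C *
           Theta 2^-1 (ci R * (coordRn a j ^+ 2 / coordRn l j)%:C%C)))
  /\
  (exists gamma0 : R, 0 < gamma0 /\
     forall (a l : Rn R d), Lambda a -> Lambda l ->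
       let gamma := min_ord (fun j => coordRn a j ^+ 2 / coordRn l j) in
       gamma0 <= gamma ->
       \prod_(j < d) (((coordRn l j) `^ (- 2^-1))%:C%C *
         Theta 2^-1 (ci R * (coordRn a j ^+ 2 / coordRn l j)%:C%C)) <=
       ((1 + 5 * d%:R * expR (- pi * gamma)) *
         integralRn (fun x => L_scaled l a x))%:C%C).

Proof.
have cE (l : R) : 0 < l -> l `^ (- 2^-1) = (Num.sqrt l)^-1.
  by move=> l0; rewrite powRN -powR12_sqrt// ltW.
have prodE (a l : Rn R d) : Lambda a -> Lambda l ->
    \prod_(j < d) (((coordRn l j) `^ (- 2^-1))%:C%C *
      Theta 2^-1 (ci R * (coordRn a j ^+ 2 / coordRn l j)%:C%C)) =
    (\prod_(j < d) ((Num.sqrt (coordRn l j))^-1 *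
      theta (coordRn a j ^+ 2 / coordRn l j) 1))%:C%C.
  move=> La Ll; rewrite rmorph_prod; apply: eq_bigr => j _.
  by rewrite Theta_half ?divr_gt0 ?exprn_gt0 ?La ?Ll// cE ?Ll// rmorphM.
split=> [a l La Ll F IF FG F0|].
  by rewrite prodE// lecR; exact: integral_le_theta.
have d0 : 0 < d%:R :> R by rewrite ltr0n.
have d1 : 1 <= d%:R :> R by rewrite ler1n.
(* This yields exp(pi gamma) >= 1 + pi gamma >= gamma >= 100 d, that is d q <= 1/100, and a fortiori
   q <= 1/9. *)
exists (100 * d%:R); split; first by rewrite mulr_gt0.
move=> a l La Ll gamma hgamma; rewrite prodE// lecR.
have -> : integralRn (fun x => L_scaled l a x) = _ := (has_integral_L_scaled La Ll).2.
have g0 : 0 < gamma by apply: lt_le_trans hgamma; rewrite mulr_gt0.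
have small : d%:R * expR (- pi * gamma) <= 100^-1.
  rewrite mulNr expRN ler_pdivrMr ?expR_gt0// ler_pdivlMl//.
  apply: (le_trans hgamma); apply: le_trans (expR_ge1Dx _).
  rewrite -[leLHS]add0r; apply: lerD => //.
  by rewrite ler_peMl ?(ltW g0)// (le_trans _ (pi_ge2 R))// ler1n.
have gj j : 0 < coordRn a j ^+ 2 / coordRn l j by rewrite divr_gt0 ?exprn_gt0 ?La ?Ll.
have qj j : expR (- pi * (coordRn a j ^+ 2 / coordRn l j)) <= expR (- pi * gamma).
  by rewrite ler_expR !mulNr lerN2 ler_wpM2l ?pi_ge0//; exact: min_ord_le.
have q9 j : expR (- pi * (coordRn a j ^+ 2 / coordRn l j)) <= 9^-1.
  apply: (le_trans (qj j)); have := expR_gt0 (- pi * gamma); move: small.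
  by move: (expR _) (d%:R : R) d1 => q D d1 small q0; nra.
apply: (prod_le_linearized (q := fun j => expR (- pi * (coordRn a j ^+ 2 / coordRn l j)))) => //.
- by move=> j; rewrite invr_gt0 sqrtr_gt0 Ll.
- by move=> j; rewrite theta1_ge0//= theta1_le_theta0.
- by move=> j; exact: theta0_ge1.
- by move=> j; exact: theta_ratio.
Qed.
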